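(* Let $E$ be a finite acyclic directed graph and let $k$ be a positive integer. The following are equivalent: (a) the gauge action of $\mathbb{Z}/k$ on $C^*(E)$ is free; (b) $\mathrm{dim}^{\mathbb{Z}/k}_{\mathrm{WLT}}(C^*(E))$ is finite; (c) for each sink $v$ of $E$, there exists a path of length $k-1$ in $E$ terminating at $v$.
   Context: A directed graph is $E=(E^0,E^1,r,s)$ with vertex set $E^0$, edge set $E^1$, and range and source maps $r,s:E^1\to E^0$; finite means $E^0$ and $E^1$ are finite. A sink is a vertex emitting no edges. A path of length $m\ge 1$ is a sequence of edges $e_1\cdots e_m$ with $r(e_j)=s(e_{j+1})$; paths of length $0$ are the vertices. $C^*(E)$ is the universal $C^*$-algebra generated by mutually orthogonal projections $P_v$ ($v\in E^0$) and partial isometries $S_e$ ($e\in E^1$) with mutually orthogonal ranges such that $S_e^*S_e=P_{r(e)}$, $S_eS_e^*\le P_{s(e)}$, and $P_v=\sum_{e\in s^{-1}(v)}S_eS_e^*$ whenever $s^{-1}(v)$ is nonempty and finite. The gauge action of $\mathbb{S}^1$ is $S_e\mapsto\lambda S_e$, $P_v\mapsto P_v$ for $\lambda\in\mathbb{S}^1$; the gauge action of $\mathbb{Z}/k$ is its restriction to the $k$th roots of unity. Freeness: an action $\alpha$ of a compact abelian group $G$ on a unital $C^*$-algebra $A$ is free (in the sense of Ellwood, equivalently saturated in the sense of Rieffel) if and only if for every character $\lambda\in\widehat G$, with $A_\lambda=\{a\in A:\alpha_g(a)=\lambda(g)a\ \forall g\in G\}$, one has $1\in A_\lambda A_\lambda^*$,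 where $A_\lambda A_\lambda^*$ is the closed linear span of $\{ab^*:a,b\in A_\lambda\}$. Weak local-triviality dimension: let a compact group $G$ act on a unital $C^*$-algebra $A$. Equip $C(G)$ with $(\alpha_gf)(h)=f(hg)$ and $C_0((0,1])\otimes C(G)$ with the action on the second factor, and let $t$ be the identity function in $C_0((0,1])$. $\mathrm{dim}^G_{\mathrm{WLT}}(A)$ is the smallest $n\ge0$ for which there exist $G$-equivariant $*$-homomorphisms $\rho_0,\ldots,\rho_n:C_0((0,1])\otimes C(G)\to A$ such that $\sum_{i=0}^n\rho_i(t\otimes1)$ is invertible ($\infty$ if no such $n$ exists). *)

(* Defs.v *)
From HB Require Import structures.
From mathcomp Require Import all_boot all_order all_algebra all_fingroup.
From mathcomp Require Import complex.
From mathcomp Require Import all_classical all_reals all_analysis.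

Set Implicit Arguments.
Unset Strict Implicit.
Unset Printing Implicit Defensive.

Import Order.TTheory GRing.Theory Num.Theory.
Import numFieldNormedType.Exports.

Local Open Scope classical_set_scope.
Local Open Scope ring_scope.

Reserved Notation "x ** y" (at level 40, left associativity).

(* The multiplication is a separate operation, not that of a [nzRingType]: the
   algebras below need not be unital, and the unital ones may be zero (the C*-algebra
   of the empty graph is). *)
HB.mixin Record isStarAlgebra (C : numClosedFieldType) A of GRing.Lmodule C A := {
  smul : A -> A -> A;
  star : A -> A;
  smulA : associative smul;
  smulDl : left_distributive smul +%R;
  smulDr : right_distributive smul +%R;
  smulZl : forall (a : C) (x y : A), smul (a *: x) y = a *: smul x y;
  smulZr : forall (a : C) (x y : A), smul x (a *: y) = a *: smul x y;
  starK : involutive star;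
  starD : forall x y : A, star (x + y) = star x + star y;
  starZ : forall (a : C) (x : A), star (a *: x) = a^* *: star x;
  starM : forall x y : A, star (smul x y) = smul (star y) (star x)
}.

#[short(type="starAlgType")]
HB.structure Definition StarAlgebra (C : numClosedFieldType) :=
  {A of isStarAlgebra C A & GRing.Lmodule C A}.

Notation "x ** y" := (smul x y) : ring_scope.

HB.mixin Record StarAlgebra_isCStar (C : numClosedFieldType) A
    of CompleteNormedModule C A & StarAlgebra C A := {
  normM_le : forall x y : A, `|x ** y| <= `|x| * `|y|;
  norm_starM : forall x : A, `|star x ** x| = `|x| ^+ 2
}.

#[short(type="cstarAlgType")]
HB.structure Definition CStarAlgebra (C : numClosedFieldType) :=
  {A of StarAlgebra_isCStar C A & CompleteNormedModule C A & StarAlgebra C A}.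

HB.mixin Record StarAlgebra_isUnital (C : numClosedFieldType) A
    of StarAlgebra C A := {
  sone : A;
  smul1x : left_id sone (@smul C A);
  smulx1 : right_id sone (@smul C A)
}.

#[short(type="unitalCstarAlgType")]
HB.structure Definition UnitalCStarAlgebra (C : numClosedFieldType) :=
  {A of StarAlgebra_isUnital C A & CStarAlgebra C A}.

Definition invertible (C : numClosedFieldType) (A : unitalCstarAlgType C) (x : A) :=
  exists y : A, x ** y = sone /\ y ** x = sone.

(* The order of a C*-algebra: the positive elements are the c^* c. *)
Definition cstar_le (C : numClosedFieldType) (A : cstarAlgType C) (x y : A) :=
  exists c : A, y - x = star c ** c.

Definition is_projection (C : numClosedFieldType) (A : cstarAlgType C) (p : A) :=
  star p = p /\ p ** p = p.

Definition is_partial_isometry (C : numClosedFieldType) (A : cstarAlgType C) (x : A) :=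
  x ** star x ** x = x.

Record starHom (C : numClosedFieldType) (A B : starAlgType C) := StarHom {
  star_hom :> {linear A -> B};
  star_homM : forall x y, star_hom (x ** y) = star_hom x ** star_hom y;
  star_homS : forall x, star_hom (star x) = star (star_hom x)
}.

Section StarHom.
Context (C : numClosedFieldType) (A B D : starAlgType C).

Lemma star_hom_idM (x y : A) : idfun (x ** y) = idfun x ** idfun y.
Proof. by []. Qed.

Lemma star_hom_idS (x : A) : idfun (star x) = star (idfun x).
Proof. by []. Qed.

Definition starHom_id : starHom A A :=
  @StarHom C A A (idfun : {linear A -> A}) star_hom_idM star_hom_idS.

Variables (phi : starHom A B) (psi : starHom B D).

Lemma star_hom_compM x y : (psi \o phi) (x ** y) = (psi \o phi) x ** (psi \o phi) y.
Proof. by rewrite /= !star_homM. Qed.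

Lemma star_hom_compS x : (psi \o phi) (star x) = star ((psi \o phi) x).
Proof. by rewrite /= !star_homS. Qed.

Definition starHom_comp : starHom A D :=
  @StarHom C A D (psi \o phi : {linear A -> D}) star_hom_compM star_hom_compS.

End StarHom.

(* The groups that act are finite and discrete, so that every map on them is
   continuous. *)
Record cstar_action (C : numClosedFieldType) (G : finGroupType) (A : cstarAlgType C) :=
  CStarAction {
    act :> G -> starHom A A;
    act1 : forall a, act 1%g a = a;
    actM : forall g h a, act (g * h)%g a = act g (act h a)
  }.

Section Freeness.
Context (C : numClosedFieldType) (G : finGroupType).

Definition is_character (chi : G -> C) :=
  (forall g, `|chi g| = 1) /\ (forall g h, chi (g * h)%g = chi g * chi h).

Definition spectral_subspace (A : cstarAlgType C) (alpha : cstar_action G A)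
    (chi : G -> C) : set A :=
  [set a | forall g, alpha g a = chi g *: a].

Definition lin_span (A : lmodType C) (S : set A) : set A :=
  [set x | exists (n : nat) (c : 'I_n -> C) (s : 'I_n -> A),
      (forall i, S (s i)) /\ x = \sum_(i < n) c i *: s i].

(* For abelian G. *)
Definition free_action (A : unitalCstarAlgType C) (alpha : cstar_action G A) :=
  forall chi : G -> C, is_character chi ->
    closure (lin_span [set x | exists a b : A,
        [/\ spectral_subspace alpha chi a, spectral_subspace alpha chi b
          & x = a ** star b]]) sone.

End Freeness.

(* C_0((0,1]): an element is represented by its extension by zero to the real line,
   and vanishing at infinity on (0,1] is continuity on [0,1] of that extension. *)
Section HalfOpenInterval.
Context (R : realType).

Definition C0_pred : {pred R -> R[i]} := fun f =>
  `[< {within `[0, 1], continuous (f : R -> (R[i])^o)} /\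
      forall x, ~ (0 < x <= 1) -> f x = 0 >].

Record C0_01 := C0Fun { C0_val :> R -> R[i]; C0_valP : C0_val \in C0_pred }.

HB.instance Definition _ := [isSub for C0_val].
HB.instance Definition _ := [Choice of C0_01 by <:].

Lemma C0_predP f : reflect ({within `[0, 1], continuous (f : R -> (R[i])^o)} /\
      forall x, ~ (0 < x <= 1) -> f x = 0) (f \in C0_pred).
Proof. exact: asboolP. Qed.

Lemma C0_submod : submod_closed C0_pred.
Proof.
split=> [|a f g /C0_predP[fc f0] /C0_predP[gc g0]]; apply/C0_predP; split.
- by move=> x; exact: cst_continuous.
- by [].
- move=> x; apply: (@cvgD _ (R[i])^o); last exact: gc.
  by apply: (@cvgZl_tmp _ (R[i])^o); exact: fc.
- by move=> x hx; rewrite !fctE f0 // g0 // scaler0 addr0.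
Qed.

HB.instance Definition _ := GRing.isSubmodClosed.Build _ _ C0_pred C0_submod.
HB.instance Definition _ := [SubChoice_isSubLmodule of C0_01 by <:].

Lemma C0_mul_subproof (f g : C0_01) : (fun x => f x * g x) \in C0_pred.
Proof.
case: f g => f /= /C0_predP[fc f0] [g /= /C0_predP[gc g0]].
apply/C0_predP; split=> [x|x hx]; last by rewrite f0 // mul0r.
exact: (cvgM (fc x) (gc x)).
Qed.

Lemma C0_star_subproof (f : C0_01) : (fun x => (f x)^*) \in C0_pred.
Proof.
case: f => f /= /C0_predP[fc f0].
apply/C0_predP; split=> [x|x hx]; last by rewrite f0 // conjC0.
apply/(@cvgrPdist_le _ (R[i])^o) => e e0.
have /(@cvgrPdist_le _ (R[i])^o)/(_ e e0) := fc x.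
apply: filterS => y /= xy.
suff: `|(f x)^* - (f y)^*| <= e by [].
by rewrite -rmorphB norm_conjC.
Qed.

Definition C0_mul (f g : C0_01) : C0_01 := C0Fun (C0_mul_subproof f g).
Definition C0_star (f : C0_01) : C0_01 := C0Fun (C0_star_subproof f).

Lemma C0_ext (f g : C0_01) : (forall x, f x = g x) -> f = g.
Proof. by move=> fg; apply: val_inj; apply/funext. Qed.

Lemma C0_mulA : associative C0_mul.
Proof. by move=> f g h; apply: C0_ext => x; exact: mulrA. Qed.

Lemma C0_mulDl : left_distributive C0_mul +%R.
Proof. by move=> f g h; apply: C0_ext => x; exact: mulrDl. Qed.

Lemma C0_mulDr : right_distributive C0_mul +%R.
Proof. by move=> f g h; apply: C0_ext => x; exact: mulrDr. Qed.

Lemma C0_mulZl (a : R[i]) (f g : C0_01) : C0_mul (a *: f) g = a *: C0_mul f g.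
Proof. by apply: C0_ext => x; rewrite /= -[RHS]/(a * (f x * g x)) mulrA. Qed.

Lemma C0_mulZr (a : R[i]) (f g : C0_01) : C0_mul f (a *: g) = a *: C0_mul f g.
Proof. by apply: C0_ext => x; rewrite /= -[RHS]/(a * (f x * g x)) mulrCA. Qed.

Lemma C0_starK : involutive C0_star.
Proof. by move=> f; apply: C0_ext => x; exact: conjCK. Qed.

Lemma C0_starD (f g : C0_01) : C0_star (f + g) = C0_star f + C0_star g.
Proof. by apply: C0_ext => x; exact: rmorphD. Qed.

Lemma C0_starZ (a : R[i]) (f : C0_01) : C0_star (a *: f) = a^* *: C0_star f.
Proof. by apply: C0_ext => x; exact: rmorphM. Qed.

Lemma C0_starM (f g : C0_01) : C0_star (C0_mul f g) = C0_mul (C0_star g) (C0_star f).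
Proof. by apply: C0_ext => x; rewrite /= rmorphM mulrC. Qed.

HB.instance Definition _ := isStarAlgebra.Build R[i] C0_01
  C0_mulA C0_mulDl C0_mulDr C0_mulZl C0_mulZr C0_starK C0_starD C0_starZ C0_starM.

Lemma C0_id_subproof :
  (fun x : R => if 0 < x <= 1 then x%:C%C else 0) \in C0_pred.
Proof.
apply/C0_predP; split=> [|x]; last by case: ifP.
apply: (@subspace_eq_continuous _ _ _ (fun x : R => x%:C%C : (R[i])^o)).
  move=> x; rewrite inE /= in_itv /= => /andP[x0 x1].
  rewrite /from_subspace x1 andbT lt_neqAle x0 andbT eq_sym.
  by have [->|] := eqVneq x 0.
apply: continuous_subspaceT => x.
apply/(@cvgrPdist_le _ (R[i])^o) => e e0.
case: e e0 => e e' /=; rewrite ltcE /= => /andP[/eqP e'0 re0].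
have : \forall y \near x, `|x - y| <= e.
  have /(@cvgrPdist_le _ R^o)/(_ _ re0) : id y @[y --> x] --> x by exact: cvg_id.
  exact.
apply: filterS => y /= xy.
suff: `|x%:C%C - y%:C%C| <= e%:C%C by rewrite e'0.
by rewrite -rmorphB /= normc_def /= expr0n /= addr0 sqrtr_sqr lecR.
Qed.

(* The identity function t of (0,1]. *)
Definition C0_id : C0_01 := C0Fun C0_id_subproof.

End HalfOpenInterval.

(* [tensC G A] is the tensor product of A and C(G); since G is finite, it consists of
   the maps from G to A, and the elementary tensor of a and h is h(-) a. *)
Definition tensC (G : finGroupType) (T : Type) := {ffun G -> T}.

Section TensorWithFunctions.
Context (C : numClosedFieldType) (G : finGroupType) (A : starAlgType C).
Implicit Types (F H : tensC G A).

HB.instance Definition _ := GRing.Lmodule.on (tensC G A).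

Definition tensC_mul F H : tensC G A := [ffun h => F h ** H h].
Definition tensC_star F : tensC G A := [ffun h => star (F h)].

Lemma tensC_mulA : associative tensC_mul.
Proof. by move=> F H K; apply/ffunP => h; rewrite !ffunE smulA. Qed.

Lemma tensC_mulDl : left_distributive tensC_mul +%R.
Proof. by move=> F H K; apply/ffunP => h; rewrite !ffunE smulDl. Qed.

Lemma tensC_mulDr : right_distributive tensC_mul +%R.
Proof. by move=> F H K; apply/ffunP => h; rewrite !ffunE smulDr. Qed.

Lemma tensC_mulZl (a : C) F H : tensC_mul (a *: F) H = a *: tensC_mul F H.
Proof. by apply/ffunP => h; rewrite !ffunE smulZl. Qed.

Lemma tensC_mulZr (a : C) F H : tensC_mul F (a *: H) = a *: tensC_mul F H.
Proof. by apply/ffunP => h; rewrite !ffunE smulZr. Qed.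

Lemma tensC_starK : involutive tensC_star.
Proof. by move=> F; apply/ffunP => h; rewrite !ffunE starK. Qed.

Lemma tensC_starD F H : tensC_star (F + H) = tensC_star F + tensC_star H.
Proof. by apply/ffunP => h; rewrite !ffunE starD. Qed.

Lemma tensC_starZ (a : C) F : tensC_star (a *: F) = a^* *: tensC_star F.
Proof. by apply/ffunP => h; rewrite !ffunE starZ. Qed.

Lemma tensC_starM F H : tensC_star (tensC_mul F H) = tensC_mul (tensC_star H) (tensC_star F).
Proof. by apply/ffunP => h; rewrite !ffunE starM. Qed.

HB.instance Definition _ := isStarAlgebra.Build C (tensC G A)
  tensC_mulA tensC_mulDl tensC_mulDr tensC_mulZl tensC_mulZr
  tensC_starK tensC_starD tensC_starZ tensC_starM.

Definition tensor (a : A) (h : G -> C) : tensC G A := [ffun g => h g *: a].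

(* On elementary tensors: a (x) h |-> a (x) h(- g). *)
Definition translate (g : G) (F : tensC G A) : tensC G A := [ffun h => F (h * g)%g].

End TensorWithFunctions.

Section WeakLocalTriviality.
Context (R : realType) (G : finGroupType) (A : unitalCstarAlgType R[i]).
Variable alpha : cstar_action G A.

Definition equivariant (rho : starHom (tensC G (C0_01 R)) A) :=
  forall g F, rho (translate g F) = alpha g (rho F).

Definition WLT_cover (n : nat) :=
  exists rho : 'I_n.+1 -> starHom (tensC G (C0_01 R)) A,
    (forall i, equivariant (rho i)) /\
    invertible (\sum_(i < n.+1) rho i (tensor (C0_id R) (fun=> 1))).

(* The least n, with [None] for infinity. *)
Definition WLT_dim : option nat :=
  if pselect (exists n, `[< WLT_cover n >]) is left ex_n then Some (ex_minn ex_n)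
  else None.

End WeakLocalTriviality.

Record digraph := Digraph {
  vertex : finType;
  edge : finType;
  rng : edge -> vertex;
  src : edge -> vertex
}.

Section Graph.
Context (E : digraph).
Implicit Types (u v : vertex E) (p : seq (edge E)).

Definition sink v := forall e : edge E, src e != v.

(* [is_path u p v]: p is a path from u to v, its length is [size p], and the empty p
   is the vertex u. *)
Fixpoint is_path u p v : bool :=
  if p is e :: p' then (src e == u) && is_path (rng e) p' v else u == v.

Definition acyclic := forall u p, is_path u p u -> p = [::].

End Graph.

Section GraphAlgebra.
Context (C : numClosedFieldType) (E : digraph).

Record cuntz_krieger (B : cstarAlgType C) (P : vertex E -> B) (S : edge E -> B) := {
  ck_proj : forall v, is_projection (P v);
  ck_orth : forall v w, v != w -> P v ** P w = 0;
  ck_pisom : forall e, is_partial_isometry (S e);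
  ck_ranges : forall e f, e != f -> (S e ** star (S e)) ** (S f ** star (S f)) = 0;
  ck_rng : forall e, star (S e) ** S e = P (rng e);
  ck_src : forall e, cstar_le (S e ** star (S e)) (P (src e));
  ck_sum : forall v, (exists e, src e = v) ->
    P v = \sum_(e | src e == v) S e ** star (S e)
}.

Definition universal (A : cstarAlgType C) (P : vertex E -> A) (S : edge E -> A) :=
  forall (B : cstarAlgType C) (Q : vertex E -> B) (T : edge E -> B),
  cuntz_krieger Q T ->
  exists phi : starHom A B,
    [/\ forall v, phi (P v) = Q v,
        forall e, phi (S e) = T e
      & forall psi : starHom A B, (forall v, psi (P v) = Q v) ->
          (forall e, psi (S e) = T e) -> psi =1 phi].

(* C*(E). As E is finite, the sum of the P_v is a unit, so no generality is lost in
   asking the carrier to be unital. *)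
Record graph_algebra := GraphAlgebra {
  ga_alg :> unitalCstarAlgType C;
  ga_P : vertex E -> ga_alg;
  ga_S : edge E -> ga_alg;
  ga_ck : cuntz_krieger ga_P ga_S;
  ga_univ : universal ga_P ga_S
}.

Variable X : graph_algebra.
Local Notation P := (@ga_P X).
Local Notation S := (@ga_S X).

Lemma scaled_ck (z : C) : `|z| = 1 -> cuntz_krieger P (fun e => z *: S e).
Proof.
move=> z1; have zz : z * z^* = 1 by rewrite -normCK z1 expr1n.
have SS e : (z *: S e) ** star (z *: S e) = S e ** star (S e).
  by rewrite starZ smulZl smulZr scalerA zz scale1r.
have [prj orth pis ran rg sr sm] := ga_ck X; split=> //.
- by move=> e; rewrite /is_partial_isometry SS smulZr pis.
- by move=> e f ef; rewrite !SS ran.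
- by move=> e; rewrite starZ smulZl smulZr scalerA mulrC zz scale1r.
- by move=> e; rewrite SS.
- by move=> v ve; rewrite sm //; apply: eq_bigr => e _; rewrite SS.
Qed.

(* The gauge automorphism of an element z of the unit circle. *)
Definition gauge (z : C) (z1 : `|z| = 1) : starHom X X :=
  projT1 (cid (@ga_univ X _ _ _ (scaled_ck z1))).

Lemma gaugeP z (z1 : `|z| = 1) v : gauge z1 (P v) = P v.
Proof. by rewrite /gauge; case: cid => phi []. Qed.

Lemma gaugeS z (z1 : `|z| = 1) e : gauge z1 (S e) = z *: S e.
Proof. by rewrite /gauge; case: cid => phi []. Qed.

Lemma gauge_uniq z (z1 : `|z| = 1) (psi : starHom X X) :
  (forall v, psi (P v) = P v) -> (forall e, psi (S e) = z *: S e) -> psi =1 gauge z1.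
Proof. by rewrite /gauge; case: cid => phi [? ? uniq]; exact: uniq. Qed.

End GraphAlgebra.

Section CyclicGauge.
Context (R : realType).

Definition cis (x : R) : R[i] := (cos x +i* sin x)%C.

Lemma cisD x y : cis (x + y) = cis x * cis y.
Proof. by apply/eqP; rewrite eq_complex /= cosD sinD eqxx /= addrC. Qed.

Lemma norm_cis x : `|cis x| = 1.
Proof. by rewrite normc_def /= cos2Dsin2 sqrtr1. Qed.

Lemma cis_2pi n : cis (n%:R * (2 * pi)) = 1.
Proof.
elim: n => [|n IHn]; first by rewrite mul0r /cis cos0 sin0.
rewrite -natr1 mulrDl mul1r cisD IHn mul1r /cis.
by rewrite mulr_natl cos2pi sin2pi.
Qed.

(* For k positive this is Z/k with its addition as group law ('Z_1 is Z/2). *)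
Definition cyc (k : nat) : finGroupType := 'I_k.-1.+1.

(* j in Z/k is identified with the k-th root of unity exp(2 pi i j / k). *)
Definition root_of_unity (k : nat) (j : cyc k) : R[i] :=
  cis ((j : 'I_k.-1.+1)%:R * (2 * pi) / k.-1.+1%:R).

Lemma norm_root_of_unity k (j : cyc k) : `|root_of_unity j| = 1.
Proof. exact: norm_cis. Qed.

Lemma root_of_unity1 k : root_of_unity (1%g : cyc k) = 1.
Proof. by rewrite /root_of_unity /= !mul0r /cis cos0 sin0. Qed.

Lemma root_of_unityM k (i j : cyc k) :
  root_of_unity (i * j)%g = root_of_unity i * root_of_unity j.
Proof.
rewrite /root_of_unity -cisD -2!mulrDl -natrD /=.
set m := k.-1.+1; set n := ((i : 'I_m) + (j : 'I_m))%N.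
have m0 : m%:R != 0 :> R by rewrite pnatr_eq0.
rewrite [in RHS](divn_eq n m) natrD natrM [(_ + (n %% m)%:R) * _]mulrDl.
rewrite [(_ + (n %% m)%:R * _) / _]mulrDl.
have -> : (n %/ m)%:R * m%:R * (2 * pi) / m%:R = (n %/ m)%:R * (2 * pi) :> R.
  by rewrite mulrAC mulfK.
by rewrite cisD cis_2pi mul1r.
Qed.

Context (E : digraph) (X : graph_algebra R[i] E).

Lemma cyc_gauge1 k (a : X) : gauge X (norm_root_of_unity (1%g : cyc k)) a = a.
Proof.
rewrite -(gauge_uniq (norm_root_of_unity _) (psi := starHom_id X)) // => e.
by rewrite root_of_unity1 scale1r.
Qed.

Lemma cyc_gaugeM k (g h : cyc k) (a : X) :
  gauge X (norm_root_of_unity (g * h)%g) a =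
  gauge X (norm_root_of_unity g) (gauge X (norm_root_of_unity h) a).
Proof.
rewrite -(gauge_uniq (norm_root_of_unity _) (psi := starHom_comp
  (gauge X (norm_root_of_unity h)) (gauge X (norm_root_of_unity g)))) //.
- by move=> v; rewrite /= !gaugeP.
- by move=> e; rewrite /= gaugeS linearZ /= gaugeS scalerA root_of_unityM mulrC.
Qed.

Definition cyc_gauge (k : nat) : cstar_action (cyc k) X :=
  CStarAction (@cyc_gauge1 k) (@cyc_gaugeM k).

End CyclicGauge.

(* Main.v *)
(* For a path m to a sink v put V_m = S_m P_v and p_m = V_m V_m^*.  As E is finite and
   acyclic there are finitely many such paths, V_m^* V_m' is P_v if m = m' and 0 otherwise,
   and the p_m sum to 1.  By the uniqueness in the universal property, the gauge automorphism
   of z is conjugation by the unitary sum of the f(m) p_m for every unimodular f with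
   f(em) = z f(m); this replaces a description of C*(E) as a sum of matrix algebras.

   (b) => (a): if chi is a character, the elements a_i = rho_i(sqrt t (x) chi) lie in A_chi,
   and the sum of the a_i a_i^* is the invertible element of (b).
   (a) => (c): let z = exp(2 pi i / k) and let a be in the spectral subspace of the character
   z.  Taking f(m) = z^|m| c(m), with c = 1 on the paths to v and c = 1 or c = -1 on the
   others, one gets P_v a V_m = z f(m) P_v a V_m, so P_v a V_m = 0 unless m ends at v and
   k divides |m| + 1.  Without paths of length k - 1 to v this gives P_v a = 0, and freeness
   forces P_v = 0.  That P_v is not 0 is seen in the representation of E on the Hilbert space
   with the paths to sinks as orthonormal basis.
   (c) => (b): each path to a sink v belongs to a system W_0, ..., W_{k-1} of operators V_m,
   with m a path to v and |m| = j mod k for W_j.  The Fourier transforms of the W_j give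
   orthogonal projections q_h, permuted by the gauge action of Z/k, and F |-> sum of the
   F(h)(1) q_h is an equivariant *-homomorphism. *)

Require Import Defs.
From HB Require Import structures.
From mathcomp Require Import all_boot all_order all_algebra all_fingroup.
From mathcomp Require Import complex.
From mathcomp Require Import all_classical all_reals all_analysis.
From mathcomp Require Import lra zify.

Set Implicit Arguments.
Unset Strict Implicit.
Unset Printing Implicit Defensive.

Import Order.TTheory GRing.Theory Num.Theory.
Import numFieldNormedType.Exports.

(** * The C*-algebra of complex matrices *)

Section OperatorNorm.
Local Open Scope ring_scope.
Local Open Scope sesquilinear_scope.
Local Open Scope classical_set_scope.
Context (R : realType) (n : nat).
Local Notation C := R[i].
Implicit Types (v w : 'rV[C]_n) (A B : 'M[C]_n).

Definition vnorm v : C := sqrtC (dotmx v v).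

Lemma vnorm_ge0 v : 0 <= vnorm v.
Proof. by rewrite /vnorm sqrtC_ge0 dnorm_ge0. Qed.

Lemma vnorm_eq0 v : (vnorm v == 0) = (v == 0).
Proof. by rewrite /vnorm sqrtC_eq0 dnorm_eq0. Qed.

Lemma vnorm0 : vnorm 0 = 0.
Proof. by apply/eqP; rewrite vnorm_eq0. Qed.

Lemma vnormZ (a : C) v : vnorm (a *: v) = `|a| * vnorm v.
Proof. by rewrite /vnorm dnormZ sqrtCM ?nnegrE ?exprn_ge0 ?dnorm_ge0 // sqrCK. Qed.

Lemma vnormD v w : vnorm (v + w) <= vnorm v + vnorm w.
Proof. exact: (triangle_lerif (@dotmx C n : {dot _ for _}) v w).1. Qed.

Lemma vnorm_sum I (r : seq I) (F : I -> 'rV[C]_n) :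
  vnorm (\sum_(i <- r) F i) <= \sum_(i <- r) vnorm (F i).
Proof.
elim/big_rec2: _ => [|i v w _ vw]; first by rewrite vnorm0.
by apply: le_trans (vnormD _ _) _; rewrite lerD2l.
Qed.

Lemma sqr_vnorm v : vnorm v ^+ 2 = dotmx v v.
Proof. exact: sqrtCK. Qed.

Lemma dotmx_adj v w A : dotmx (v *m A) w = dotmx v (w *m A^t*).
Proof. by rewrite !dotmxE trmx_mul map_mxM trmxCK mulmxA. Qed.

Lemma cauchy_schwarz v w : `|dotmx v w| <= vnorm v * vnorm w.
Proof. exact: (CauchySchwarz_sqrt (@dotmx C n : {dot _ for _}) v w).1. Qed.

Lemma entry_le_vnorm v i : `|v 0 i| <= vnorm v.
Proof.
rewrite -(@ler_pXn2r _ 2) ?nnegrE ?vnorm_ge0 // sqr_vnorm dotmxE mxE.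
rewrite (bigD1 i) //= !mxE -normCK lerDl sumr_ge0 // => j _.
by rewrite !mxE -normCK exprn_ge0.
Qed.

Lemma vnorm_mul_le A v : vnorm (v *m A) <= (\sum_i vnorm (row i A)) * vnorm v.
Proof.
rewrite mulmx_sum_row mulr_suml; apply: le_trans (vnorm_sum _ _) _.
apply: ler_sum => i _; rewrite vnormZ mulrC ler_wpM2l ?vnorm_ge0 //.
exact: entry_le_vnorm.
Qed.

(** Matrices act on row vectors from the right. The supremum is taken in [R], through real parts,
    since [vnorm] has its values in [R[i]], as the norm of a normed module over [R[i]] must. *)
Definition unit_ball_gain A : set R :=
  [set complex.Re (vnorm (v *m A)) | v in [set v | vnorm v <= 1]].

Definition opnorm A : C := (sup (unit_ball_gain A))%:C%C.

Lemma ge0_ReK (z : C) : 0 <= z -> (complex.Re z)%:C%C = z.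
Proof. by move=> z0; rewrite RRe_real ?ger0_real. Qed.

Lemma opnorm_le A c : 0 <= c -> (forall v, vnorm (v *m A) <= c * vnorm v) ->
  opnorm A <= c.
Proof.
move=> c0 Ac; rewrite /opnorm -(ge0_ReK c0) lecR; apply: ge_sup.
  exists (complex.Re (vnorm (0 *m A))), 0 => //=.
  by rewrite vnorm0.
move=> _ [v /= v1 <-]; rewrite -lecR !ge0_ReK ?vnorm_ge0 //.
by apply: le_trans (Ac v) _; rewrite -[leRHS]mulr1 ler_wpM2l.
Qed.

Lemma has_sup_gain A : has_sup (unit_ball_gain A).
Proof.
split; first by exists (complex.Re (vnorm (0 *m A))), 0 => //=;
  rewrite vnorm0.
have s0 : 0 <= \sum_i vnorm (row i A) by rewrite sumr_ge0 // => i _; exact: vnorm_ge0.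
exists (complex.Re (\sum_i vnorm (row i A))) => _ [v /= v1 <-].
rewrite -lecR !ge0_ReK ?vnorm_ge0 //; apply: le_trans (vnorm_mul_le A v) _.
by rewrite -[leRHS]mulr1 ler_wpM2l.
Qed.

Lemma opnormP A v : vnorm (v *m A) <= opnorm A * vnorm v.
Proof.
have [->|v0] := eqVneq v 0.
  by rewrite mul0mx vnorm0 mulr0.
have nv0 : 0 < vnorm v by rewrite lt_neqAle vnorm_ge0 eq_sym vnorm_eq0 v0.
rewrite -ler_pdivrMr // mulrC -(@ger0_norm _ (vnorm v)^-1) ?invr_ge0 ?vnorm_ge0 //.
rewrite -vnormZ scalemxAl -[leLHS]ge0_ReK ?vnorm_ge0 // /opnorm lecR.
apply: sup_upper_bound; first exact: has_sup_gain.
exists ((vnorm v)^-1 *: v) => //=.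
by rewrite vnormZ ger0_norm ?invr_ge0 ?vnorm_ge0 // mulVf // gt_eqF.
Qed.

Lemma opnorm_ge0 A : 0 <= opnorm A.
Proof.
rewrite /opnorm ler0c; have [_ ub] := has_sup_gain A.
apply: (ub_le_sup ub); exists 0 => /=.
  by rewrite vnorm0.
by rewrite mul0mx vnorm0.
Qed.

Lemma vnorm_delta i : vnorm (delta_mx 0 i) = 1.
Proof.
by rewrite /vnorm dotmxE trmx_delta map_delta_mx mul_delta_mx mxE !eqxx sqrtC1.
Qed.

Opaque vnorm opnorm.

Lemma opnormD A B : opnorm (A + B) <= opnorm A + opnorm B.
Proof.
apply: opnorm_le => [|v]; first by rewrite addr_ge0 ?opnorm_ge0.
by rewrite mulmxDr mulrDl (le_trans (vnormD _ _)) // lerD ?opnormP.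
Qed.

Lemma opnorm_eq0 A : opnorm A = 0 -> A = 0.
Proof.
move=> A0; apply/row_matrixP => i; rewrite row0 rowE; apply/eqP.
by rewrite -vnorm_eq0 eq_le vnorm_ge0 (le_trans (opnormP _ _)) // A0 mul0r.
Qed.

Lemma opnormZ_le (a : C) A : opnorm (a *: A) <= `|a| * opnorm A.
Proof.
apply: opnorm_le => [|v]; first by rewrite mulr_ge0 ?opnorm_ge0.
by rewrite -scalemxAr vnormZ -mulrA ler_wpM2l ?opnormP.
Qed.

Lemma opnormZ (a : C) A : opnorm (a *: A) = `|a| * opnorm A.
Proof.
have [->|a0] := eqVneq a 0.
  apply/eqP; rewrite eq_le opnormZ_le normr0 mul0r.
  exact: opnorm_ge0.
apply/eqP; rewrite eq_le opnormZ_le /= mulrC -ler_pdivlMr ?normr_gt0 // mulrC -normfV.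
by rewrite -{1}[A](scalerK a0) opnormZ_le.
Qed.

Lemma opnormM A B : opnorm (A *m B) <= opnorm A * opnorm B.
Proof.
apply: opnorm_le => [|v]; first by rewrite mulr_ge0 ?opnorm_ge0.
rewrite mulmxA; apply: le_trans (opnormP B _) _.
rewrite mulrAC [leRHS]mulrC.
exact: (ler_wpM2l (opnorm_ge0 B) (opnormP A v)).
Qed.

(** Cauchy-Schwarz for v and v A A^*. Both the isometry of the adjoint and the C*-identity come from
    this bound. *)
Lemma sqr_vnorm_mul A v : vnorm (v *m A) ^+ 2 <= vnorm v * vnorm (v *m (A *m A^t*)).
Proof.
rewrite sqr_vnorm dotmx_adj -mulmxA -[leLHS]ger0_norm; first exact: cauchy_schwarz.
by rewrite mulmxA -dotmx_adj dnorm_ge0.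
Qed.

Lemma opnorm_adj_le A : opnorm (A^t*) <= opnorm A.
Proof.
apply: opnorm_le => [|v]; first exact: opnorm_ge0.
have := sqr_vnorm_mul (A^t*) v; rewrite trmxCK mulmxA.
have [->|v0] := eqVneq (v *m A^t*) 0.
  by move=> _; rewrite vnorm0; apply: mulr_ge0; [exact: opnorm_ge0|exact: vnorm_ge0].
have nv0 : 0 < vnorm (v *m A^t*) by rewrite lt_neqAle vnorm_ge0 eq_sym vnorm_eq0 v0.
move=> vA; rewrite -(ler_pM2r nv0); apply: (le_trans vA).
rewrite mulrAC [leRHS]mulrC; apply: (ler_wpM2l (vnorm_ge0 v)).
exact: opnormP.
Qed.

Lemma opnorm_adj A : opnorm (A^t*) = opnorm A.
Proof.
apply: le_anti; apply/andP; split; first exact: opnorm_adj_le.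
by have := opnorm_adj_le (A^t*); rewrite trmxCK.
Qed.

Lemma entry_le_opnorm A i j : `|A i j| <= opnorm A.
Proof.
have -> : A i j = (delta_mx 0 i *m A : 'rV__) 0 j by rewrite -rowE mxE.
apply: le_trans (entry_le_vnorm _ _) _; apply: le_trans (opnormP _ _) _.
by rewrite vnorm_delta mulr1.
Qed.

(** For the lower bound on the left side, [sqr_vnorm_mul] at A^* bounds the gain of A^* by the
    square root of the norm of A^* A, and A^* has the norm of A. *)
Lemma opnorm_cstar A : opnorm (A^t* *m A) = opnorm A ^+ 2.
Proof.
apply/eqP; rewrite eq_le; apply/andP; split.
  by rewrite expr2 -{1}(opnorm_adj A); exact: opnormM.
have s0 : 0 <= sqrtC (opnorm (A^t* *m A)) by rewrite sqrtC_ge0; exact: opnorm_ge0.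
rewrite -(opnorm_adj A) -[leRHS]sqrtCK; apply: lerXn2r; rewrite ?nnegrE //.
  exact: opnorm_ge0.
apply: opnorm_le => // v.
have sv0 : 0 <= sqrtC (opnorm (A^t* *m A)) * vnorm v.
  by apply: mulr_ge0 => //; exact: vnorm_ge0.
rewrite -(@ler_pXn2r _ 2) ?nnegrE ?vnorm_ge0 ?sv0 //.
rewrite [leRHS]exprMn [X in X * _]sqrtCK; apply: le_trans (sqr_vnorm_mul (A^t*) v) _.
rewrite trmxCK expr2 mulrA [leRHS]mulrC; apply: (ler_wpM2l (vnorm_ge0 v)).
exact: opnormP.
Qed.

End OperatorNorm.

(** * Completeness of the complex numbers *)

Section ComplexComplete.
Local Open Scope ring_scope.
Local Open Scope classical_set_scope.
Context (R : realType).
Local Notation C := R[i].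

Lemma normc_i : `|'i%C : C| = 1.
Proof. by rewrite normc_def /= expr0n /= add0r expr1n sqrtr1. Qed.

Lemma normc_ge_Im (z : C) : `|complex.Im z|%:C%C <= `|z|.
Proof.
by rewrite -[`|z|]mulr1 -normc_i -normrM -normrN -ReiNIm normc_ge_Re.
Qed.

Lemma normc_real (x : R) : `|x%:C%C : C| = `|x|%:C%C.
Proof. by rewrite normc_def /= expr0n /= addr0 sqrtr_sqr. Qed.

Lemma normc_le_ReIm (z : C) : `|z| <= (`|complex.Re z| + `|complex.Im z|)%:C%C.
Proof.
rewrite {1}[z]complexE (le_trans (ler_normD _ _)) // rmorphD /= normrM.
by rewrite normc_i mul1r !normc_real.
Qed.

(** Real and imaginary parts are contractions, so they push a Cauchy filter to Cauchy filters on
    [R], whose limits are then recombined. *)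
Lemma complex_cvg (F : set_system C^o) : ProperFilter F ->
  cauchy F -> exists l : C^o, F --> l.
Proof.
move=> FF /cauchyP Fc.
have part (p : C -> R) : (forall x y, `|p x - p y|%:C%C <= `|x - y|) ->
    exists l : R, p x @[x --> F] --> l.
  move=> pB; apply/cvg_ex; apply: (@R_complete R); apply: cauchy_exP => e e0.
  have [|x Fx] := Fc e%:C%C; first by rewrite ltcR.
  exists (p x); change (F [set y | ball (p x) e (p y)]).
  apply: filterS Fx => y /= xy.
  by rewrite /ball /= -ltcR; apply: le_lt_trans (pB _ _) _.
have [|a Fa] := part (@complex.Re R).
  by move=> x y; rewrite -raddfB normc_ge_Re.
have [|b Fb] := part (@complex.Im R).
  by move=> x y; rewrite -raddfB normc_ge_Im.
exists (a +i* b)%C; apply/cvgrPdist_lt => e; rewrite ltcE /= => /andP[/eqP e'0 e0].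
have e20 : 0 < complex.Re e / 2 by rewrite divr_gt0.
move/cvgrPdist_lt : Fa => /(_ _ e20) Fa; move/cvgrPdist_lt : Fb => /(_ _ e20) Fb.
apply: filterS2 Fa Fb => y /= ya yb.
apply: le_lt_trans (normc_le_ReIm _) _; rewrite ltcE /= e'0 eqxx /=.
by rewrite [ltRHS]splitr !raddfB /=; apply: ltrD.
Qed.
End ComplexComplete.

(** * Matrices as a C*-algebra *)

Section OperatorAlgebra.
Local Open Scope ring_scope.
Local Open Scope classical_set_scope.
Local Open Scope sesquilinear_scope.
Context (R : realType) (n : nat).
Local Notation C := R[i].

Definition opmx := 'M[C]_n.

HB.instance Definition _ := GRing.Lmodule.on opmx.

HB.instance Definition _ := Lmodule_isNormed.Build C opmx
  (@opnormD R n) (@opnormZ R n) (@opnorm_eq0 R n).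

(** Entries are dominated by the operator norm, hence converge; writing a matrix as a finite sum of
    multiples of matrix units turns entrywise convergence into norm convergence. *)
Lemma opmx_cvg (F : set_system opmx) : ProperFilter F ->
  cauchy F -> cvg F.
Proof.
move=> FF /cauchyP Fc.
have entry i j : exists l : C^o, (fun A : opmx => (A i j : C^o)) @ F --> l.
  apply: complex_cvg; apply: cauchy_exP => e e0.
  have [A FA] := Fc e e0; exists (A i j).
  change (F [set B : opmx | ball (A i j : C^o) e (B i j)]).
  apply: filterS FA => B /= AB.
  apply: le_lt_trans AB.
  by have := entry_le_opnorm (A - B) i j; rewrite !mxE.
have /choice[L /= FL] : forall ij : 'I_n * 'I_n, exists l : C^o,
   (fun A : opmx => (A ij.1 ij.2 : C^o)) @ F --> l by move=> [i j]; exact: entry.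
apply/cvg_ex; exists (\sum_i \sum_j L (i, j) *: (delta_mx i j : opmx)).
have -> : F = (fun A : opmx => \sum_i \sum_j A i j *: (delta_mx i j : opmx)) @ F.
  by under eq_fun do rewrite -matrix_sum_delta.
apply: cvg_big => [|i _]; first exact: add_continuous.
apply: cvg_big => [|j _]; first exact: add_continuous.
apply: cvgZr_tmp.
exact: (FL (i, j)).
Qed.

HB.instance Definition _ := Uniform_isComplete.Build opmx opmx_cvg.

Implicit Types A B : opmx.
Definition opmx_mul A B : opmx := A *m B.
Definition opmx_star A : opmx := A^t*.

Lemma opmx_mulA : associative opmx_mul.
Proof. exact: mulmxA. Qed.
Lemma opmx_mulDl : left_distributive opmx_mul +%R.
Proof. exact: mulmxDl. Qed.
Lemma opmx_mulDr : right_distributive opmx_mul +%R.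
Proof. exact: mulmxDr. Qed.
Lemma opmx_mulZl (a : C) A B : opmx_mul (a *: A) B = a *: opmx_mul A B.
Proof. by rewrite [LHS](esym (scalemxAl _ _ _)). Qed.
Lemma opmx_mulZr (a : C) A B : opmx_mul A (a *: B) = a *: opmx_mul A B.
Proof. by rewrite [LHS](esym (scalemxAr _ _ _)). Qed.
Lemma opmx_starK : involutive opmx_star.
Proof. exact: trmxCK. Qed.
Lemma opmx_starD A B : opmx_star (A + B) = opmx_star A + opmx_star B.
Proof. by apply/matrixP => i j; rewrite !mxE rmorphD. Qed.
Lemma opmx_starZ (a : C) A : opmx_star (a *: A) = a^* *: opmx_star A.
Proof. by apply/matrixP => i j; rewrite !mxE rmorphM. Qed.
Lemma opmx_starM A B : opmx_star (opmx_mul A B) = opmx_mul (opmx_star B) (opmx_star A).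
Proof. by rewrite /opmx_star /opmx_mul trmx_mul map_mxM. Qed.

HB.instance Definition _ := isStarAlgebra.Build C opmx
  opmx_mulA opmx_mulDl opmx_mulDr opmx_mulZl opmx_mulZr
  opmx_starK opmx_starD opmx_starZ opmx_starM.

HB.instance Definition _ := StarAlgebra_isCStar.Build C opmx
  (@opnormM R n) (@opnorm_cstar R n).
End OperatorAlgebra.


(** * Paths to sinks *)

Section SinkPaths.
Context (E : digraph).
Implicit Types (u v w : vertex E) (p q : seq (edge E)) (m : seq (edge E) * vertex E).

Definition sinkb v := [forall e : edge E, src e != v].

Lemma sinkP v : reflect (sink v) (sinkb v).
Proof. exact: forallP. Qed.

(* The source of the path m.1 with range m.2. *)
Definition start m := if m.1 is e :: _ then src e else m.2.

Definition pcons (e : edge E) m := (e :: m.1, m.2).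

(** The pair keeps the range of the path, so that the paths of length 0 at different sinks remain
    distinct. *)
Definition sink_path m := sinkb m.2 && is_path (start m) m.1 m.2.

Lemma is_path_start u p v : is_path u p v -> start (p, v) = u.
Proof. by case: p => [/eqP|e p /andP[/eqP]]. Qed.

Lemma pcons_inj e f m1 m2 : pcons e m1 = pcons f m2 -> e = f /\ m1 = m2.
Proof. by case: m1 m2 => [p v] [q w] [-> -> ->]. Qed.

Lemma sink_path_cons e m :
  sink_path (pcons e m) = (start m == rng e) && sink_path m.
Proof.
rewrite /sink_path /= eqxx /=; case: (sinkb _) => /=; last by rewrite andbF.
apply/idP/andP => [p|[/eqP <- //]].
have /= := is_path_start p; rewrite -surjective_pairing => se.
by rewrite se eqxx.
Qed.

Lemma is_path_catl u p q v : is_path u (p ++ q) v -> exists w, is_path u p w.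
Proof.
elim: p u => [|e p IHp] u /=; first by exists u.
by move=> /andP[-> /IHp[w pw]]; exists w.
Qed.

Lemma is_path_catr u p q v : is_path u (p ++ q) v -> exists w, is_path w q v.
Proof.
elim: p u => [|e p IHp] u /=; first by exists u.
by move=> /andP[_ /IHp].
Qed.

Lemma is_path_rcons u p e v : is_path u (rcons p e) v -> v = rng e.
Proof.
elim: p u => [|f p IHp] u /=; first by move=> /andP[_ /eqP].
by move=> /andP[_ /IHp].
Qed.

Hypothesis acyclicE : acyclic E.

(** A return to the vertex u would cut off a nonempty closed path at u. *)
Lemma is_path_uniq u p v : is_path u p v -> uniq (u :: map (@rng E) p).
Proof.
elim: p u => [//|e p IHp] u puv.
have /andP[_ /IHp up] := puv; apply/andP; split=> //.
apply/negP => /mapP[f fp fu]; case/splitPr: fp puv => p1 p2.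
rewrite -cat_rcons => /is_path_catl[w pw].
have := is_path_rcons pw; rewrite -fu => wu; rewrite wu in pw.
by have := acyclicE pw; case: (p1).
Qed.

Lemma size_path u p v : is_path u p v -> size p < #|vertex E|.
Proof.
move=> /is_path_uniq/card_uniqP => c.
have := max_card (mem (u :: map (@rng E) p)).
by rewrite c /= size_map.
Qed.

(** Here [n] bounds the length of the paths; by [size_path] the number of vertices is a large enough
    bound. A sink ends the recursion, since only the empty path leaves it. *)
Fixpoint sink_paths_from n u : seq (seq (edge E) * vertex E) :=
  if sinkb u then [:: ([::], u)] else
  if n is n'.+1 then
    [seq pcons e m | e <- [seq e <- enum (edge E) | src e == u],
                     m <- sink_paths_from n' (rng e)]
  else [::].

Lemma mem_sink_paths_from n u m :
  (m \in sink_paths_from n u) = [&& sink_path m, start m == u & size m.1 <= n].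
Proof.
elim: n u m => [|n IHn] u [p v] /=.
  case: ifP => [su|nsu].
    rewrite inE; apply/eqP/and3P => [[-> ->]|[]].
      by rewrite /sink_path /= su !eqxx.
    by case: p => //= _ /eqP; rewrite /start /= => ->.
  rewrite in_nil; apply/esym/and3P => -[]; case: p => //=.
  by rewrite /sink_path /start /= => /andP[sv _] /eqP vu; rewrite -vu sv in nsu.
case: ifP => [su|nsu].
  rewrite inE; apply/eqP/and3P => [[-> ->]|[]].
    by rewrite /sink_path /= su !eqxx.
  case: p => [_ /eqP|e p _ /eqP]; rewrite /start /= => eu; first by rewrite eu.
  by have /forallP/(_ e) := su; rewrite eu eqxx.
apply/allpairsPdep/and3P => [[e [m [eu mn]]]|[]].
  rewrite mem_filter in eu; have /andP[/eqP eu' _] := eu.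
  rewrite IHn in mn; case/and3P: mn => sm st sz em.
  rewrite em; split; first by rewrite sink_path_cons st.
    by rewrite /start /= eu'.
  by case: em => -> _.
case: p => [|e p].
  by rewrite /sink_path /start /= => /andP[sv _] /eqP vu; rewrite -vu sv in nsu.
rewrite -[(e :: p, v)]/(pcons e (p, v)) sink_path_cons.
rewrite /start /= => /andP[sr sp] /eqP eu sz; exists e, (p, v).
by rewrite mem_filter mem_enum eu eqxx IHn sp sr.
Qed.

Lemma uniq_sink_paths_from n u : uniq (sink_paths_from n u).
Proof.
elim: n u => [|n IHn] u /=; first by case: ifP.
case: ifP => // _; apply: allpairs_uniq_dep => //.
  by rewrite filter_uniq // enum_uniq.
by move=> [e m] [f m'] _ _ /= /pcons_inj[-> ->].
Qed.

Definition sink_paths :=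
  [seq m | u <- enum (vertex E), m <- sink_paths_from #|vertex E| u].

Lemma mem_sink_paths m : (m \in sink_paths) = sink_path m.
Proof.
apply/allpairsPdep/idP => [[u [m' [_]]]|sm].
  by rewrite mem_sink_paths_from => /and3P[sm _ _] ->.
exists (start m), m; rewrite mem_enum mem_sink_paths_from sm eqxx; split=> //=.
by case/andP: sm => _ /size_path/ltnW.
Qed.

Lemma uniq_sink_paths : uniq sink_paths.
Proof.
apply: allpairs_uniq_dep => [|u _|[u m] [v m']]; first exact: enum_uniq.
  exact: uniq_sink_paths_from.
case/allpairsPdep => u1 [m1 [_ m1P [-> ->]]].
case/allpairsPdep => u2 [m2 [_ m2P [-> ->]]] /= m12.
move: m1P m2P; rewrite !mem_sink_paths_from m12.
by move=> /and3P[_ /eqP -> _] /and3P[_ /eqP -> _].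
Qed.

(** Ordinals index the paths so that the same index set serves for sums and for matrices. *)
Definition spath (i : 'I_(size sink_paths)) := tnth (in_tuple sink_paths) i.

Lemma spath_inj : injective spath.
Proof.
move=> i j ij; have m0 := spath i; apply/val_inj/eqP.
rewrite -(nth_uniq m0 (ltn_ord i) (ltn_ord j) uniq_sink_paths).
by apply/eqP; move: ij; rewrite /spath !(tnth_nth m0).
Qed.

Lemma spathP i : sink_path (spath i).
Proof. by rewrite -mem_sink_paths mem_tnth. Qed.

Lemma spath_surj m : sink_path m -> exists i, spath i = m.
Proof.
rewrite -mem_sink_paths => /(tnthP (in_tuple sink_paths))[i ->]; by exists i.
Qed.

End SinkPaths.

(** * Elementary identities in *-algebras *)

Section StarAlgebraTheory.
Local Open Scope ring_scope.
Context (C : numClosedFieldType) (A : starAlgType C).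
Implicit Types x y : A.

Lemma smul0x x : 0 ** x = 0.
Proof. by rewrite -[X in X ** _](scale0r 0) smulZl scale0r. Qed.

Lemma smulx0 x : x ** 0 = 0.
Proof. by rewrite -[X in _ ** X](scale0r 0) smulZr scale0r. Qed.

Lemma smulNx x y : (- x) ** y = - (x ** y).
Proof. by rewrite -[- x]scaleN1r smulZl scaleN1r. Qed.

Lemma smulxN x y : x ** (- y) = - (x ** y).
Proof. by rewrite -[- y]scaleN1r smulZr scaleN1r. Qed.

Lemma smul_suml I (r : seq I) (P : pred I) (F : I -> A) y :
  (\sum_(i <- r | P i) F i) ** y = \sum_(i <- r | P i) F i ** y.
Proof. by apply: (big_morph (fun x => x ** y)) => [a b|]; rewrite ?smulDl ?smul0x. Qed.

Lemma smul_sumr I (r : seq I) (P : pred I) (F : I -> A) y :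
  y ** (\sum_(i <- r | P i) F i) = \sum_(i <- r | P i) y ** F i.
Proof. by apply: (big_morph (fun x => y ** x)) => [a b|]; rewrite ?smulDr ?smulx0. Qed.

Lemma star0 : star (0 : A) = 0.
Proof. by rewrite -[X in star X](scale0r 0) starZ conjC0 scale0r. Qed.

Lemma starN x : star (- x) = - star x.
Proof. by rewrite -scaleN1r starZ rmorphN1 scaleN1r. Qed.

Lemma star_sum I (r : seq I) (P : pred I) (F : I -> A) :
  star (\sum_(i <- r | P i) F i) = \sum_(i <- r | P i) star (F i).
Proof. by apply: (big_morph star) => [a b|]; rewrite ?starD ?star0. Qed.

End StarAlgebraTheory.

(** * Cuntz-Krieger families *)

Section CuntzKriegerFamily.
Local Open Scope ring_scope.
Context (C : numClosedFieldType) (E : digraph) (B : cstarAlgType C).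
Context (P : vertex E -> B) (S : edge E -> B) (ck : cuntz_krieger P S).

Lemma ck_starP v : star (P v) = P v.
Proof. by case: (ck_proj ck v). Qed.

Lemma ck_PP v w : P v ** P w = if v == w then P v else 0.
Proof.
by have [<-|vw] := eqVneq v w; [case: (ck_proj ck v)|rewrite (ck_orth ck)].
Qed.

Lemma ck_SP e : S e ** P (rng e) = S e.
Proof. by rewrite -(ck_rng ck) smulA (ck_pisom ck). Qed.

(** For distinct edges the range projections of S_e and S_f can be inserted between the factors, and
    these are orthogonal. *)
Lemma ck_starSS e f : star (S e) ** S f = if e == f then P (rng e) else 0.
Proof.
have [<-|ef] := eqVneq e f; first exact: (ck_rng ck).
have -> : star (S e) = star (S e) ** (S e ** star (S e)).
  by rewrite -{1}(ck_pisom ck e) !starM starK.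
rewrite -smulA -(ck_pisom ck f) [X in _ ** X]smulA (ck_ranges ck) //.
by rewrite smul0x smulx0.
Qed.

(** In the relation [ck_sum] at the source of e, only the term of e survives multiplication by
    S_e. *)
Lemma ck_srcS e : P (src e) ** S e = S e.
Proof.
rewrite (ck_sum ck); last by exists e.
rewrite smul_suml (bigD1 e) //= (ck_pisom ck) big1 ?addr0 // => f /andP[_ fe].
by rewrite -smulA ck_starSS (negbTE fe) smulx0.
Qed.

Lemma ck_PS v e : P v ** S e = if v == src e then S e else 0.
Proof.
by rewrite -ck_srcS smulA ck_PP; case: eqP => [->|_]; rewrite ?ck_srcS ?smul0x.
Qed.

(* S_{e_1} ... S_{e_n} P_v for the path e_1 ... e_n with range v. *)
Definition path_op (m : seq (edge E) * vertex E) : B :=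
  foldr (fun e x => S e ** x) (P m.2) m.1.

Lemma path_op_cons e m : path_op (pcons e m) = S e ** path_op m.
Proof. by []. Qed.

Lemma path_opP m : path_op m ** P m.2 = path_op m.
Proof.
case: m => p v; elim: p => [|e p IHp]; first by rewrite [LHS]ck_PP eqxx.
by rewrite -[(e :: p, v)]/(pcons e (p, v)) path_op_cons -smulA IHp.
Qed.

Lemma P_path_op v m : P v ** path_op m = if v == start m then path_op m else 0.
Proof.
case: m => [[|e p] w]; rewrite /start /=.
  by rewrite [LHS]ck_PP; case: eqP => [->|].
rewrite -[(e :: p, w)]/(pcons e (p, w)) path_op_cons smulA ck_PS; case: eqP => // _.
by rewrite smul0x.
Qed.

(** Equal first edges cancel and distinct ones annihilate the product. If just one path is empty,
    the product vanishes because its vertex is a sink and so is not the source of the other path's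
    first edge. *)
Lemma star_path_op m1 m2 : sink_path m1 -> sink_path m2 ->
  star (path_op m1) ** path_op m2 = if m1 == m2 then P m1.2 else 0.
Proof.
case: m1 m2 => [p v] [q w]; elim: p q => [|e p IHp] [|f q] s1 s2.
- rewrite [LHS](_ : _ = star (P v) ** P w) // ck_starP ck_PP.
  by rewrite xpair_eqE eqxx.
- rewrite [LHS](_ : _ = star (P v) ** (S f ** path_op (q, w))) // ck_starP smulA ck_PS.
  case: eqP => [vf|]; last by rewrite smul0x.
  by case/andP: s1 => /forallP/(_ f); rewrite vf eqxx.
- rewrite [LHS](_ : _ = star (S e ** path_op (p, v)) ** P w) // -[P w]ck_starP -starM.
  rewrite smulA ck_PS.
  case: eqP => [vf|]; last by rewrite smul0x star0.
  by case/andP: s2 => /forallP/(_ e); rewrite vf eqxx.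
rewrite -[(e :: p, v)]/(pcons e (p, v)) -[(f :: q, w)]/(pcons f (q, w)) in s1 s2 *.
rewrite !path_op_cons.
move: s1 s2; rewrite !sink_path_cons => /andP[/eqP st1 s1] /andP[_ s2].
rewrite starM -smulA [star (S e) ** _]smulA ck_starSS smulA.
have -> : (pcons e (p, v) == pcons f (q, w)) = (e == f) && ((p, v) == (q, w)).
  by rewrite !xpair_eqE eqseq_cons andbA.
case: (e == f) => /=; last by rewrite smulx0 smul0x.
by rewrite -[P (rng e)]ck_starP -starM P_path_op st1 eqxx; exact: IHp.
Qed.

(** The relation P_u = sum of S_e P_r(e) S_e^* is iterated until every branch has reached a sink;
    the bound on the lengths guarantees that this happens within n rounds. *)
Lemma P_eq_sum_paths n u :
  (forall p v, is_path u p v -> size p <= n)%N ->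
  P u = \sum_(m <- sink_paths_from n u) path_op m ** star (path_op m).
Proof.
elim: n u => [|n IHn] u un /=.
  case: ifPn => [su|/forallPn[e]].
    by rewrite big_seq1 /path_op /= ck_starP ck_PP eqxx.
  rewrite negbK => eu; have := un [:: e] (rng e).
  by rewrite /= eu eqxx => /(_ isT).
case: ifPn => [su|/forallPn[e0]].
  by rewrite big_seq1 /path_op /= ck_starP ck_PP eqxx.
rewrite negbK => /eqP eu0.
rewrite (ck_sum ck); last by exists e0.
rewrite big_allpairs_dep /= big_filter big_enum_cond /=.
apply: eq_bigr => e eu.
rewrite -[S e in X in X ** _]ck_SP {1}(IHn (rng e)); last first.
  by move=> p v pv; have := un (e :: p) v; rewrite /= eu pv => /(_ isT).
rewrite smul_sumr smul_suml; apply: eq_bigr => m _.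
by rewrite path_op_cons starM !smulA.
Qed.

End CuntzKriegerFamily.

(** * Construction of *-homomorphisms *)

Section StarHomOf.
Local Open Scope ring_scope.
Context (C : numClosedFieldType) (A B : starAlgType C) (f : A -> B).
Hypotheses (fL : linear f) (fM : forall x y, f (x ** y) = f x ** f y)
  (fS : forall x, f (star x) = star (f x)).

Definition starHom_linear : {linear A -> B} :=
  HB.pack f (GRing.isLinear.Build C A B *:%R f fL).

Definition starHom_of : starHom A B := @StarHom C A B starHom_linear fM fS.

Lemma starHom_ofE x : starHom_of x = f x.
Proof. by []. Qed.

End StarHomOf.

(** * Conjugation by a unitary *)

Section InnerAutomorphism.
Local Open Scope ring_scope.
Context (C : numClosedFieldType) (A : unitalCstarAlgType C) (u : A).
Hypothesis uu : star u ** u = sone.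

Let ad (x : A) := u ** x ** star u.

Lemma star_sone : star (sone : A) = sone.
Proof. by rewrite -[LHS]smulx1 -[X in _ ** X]starK -starM smulx1 starK. Qed.

Lemma ad_linear : linear ad.
Proof. by move=> a x y; rewrite /ad smulDr smulDl smulZr smulZl. Qed.

Lemma adM x y : ad (x ** y) = ad x ** ad y.
Proof. by rewrite /ad -!smulA [star u ** _]smulA uu smul1x. Qed.

Lemma adS x : ad (star x) = star (ad x).
Proof. by rewrite /ad !starM starK smulA. Qed.

Definition ad_hom : starHom A A := starHom_of ad_linear adM adS.

Lemma ad_homE x : ad_hom x = u ** x ** star u.
Proof. by []. Qed.

End InnerAutomorphism.

(** * Gauge automorphisms are inner *)

Section GaugeIsInner.
Local Open Scope ring_scope.
Context (C : numClosedFieldType) (E : digraph) (X : graph_algebra C E).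
Hypothesis acyclicE : acyclic E.
Local Notation P := (@ga_P C E X).
Local Notation S := (@ga_S C E X).
Local Notation ck := (ga_ck X).
Local Notation V i := (path_op P S (spath (E := E) i)).
Local Notation pi i := (V i ** star (V i)).
Local Notation idx := ('I_(size (sink_paths E))).

(** Uniqueness in the universal property, taken from the gauge automorphism of z = 1. *)
Lemma gauge_id (psi : starHom X X) :
  (forall v, psi (P v) = P v) -> (forall e, psi (S e) = S e) -> psi =1 id.
Proof.
move=> psiP psiS x; rewrite (gauge_uniq (normr1 C)) //; last first.
  by move=> e; rewrite scale1r.
by rewrite -(gauge_uniq (normr1 C) (psi := starHom_id X)) // => e; rewrite scale1r.
Qed.

(** Uniqueness in the universal property replaces the density of the generated *-algebra: it is used
    once to show that the sum q is central, and once more to show that multiplication by q is the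
    identity. *)
Lemma sum_P : \sum_v P v = sone.
Proof.
set q := \sum_v P v.
have qP v : q ** P v = P v.
  rewrite smul_suml (bigD1 v) //= (ck_PP ck) eqxx big1 ?addr0 // => w wv.
  by rewrite (ck_PP ck) (negbTE wv).
have qS : star q = q by rewrite star_sum; apply: eq_bigr => v _; rewrite (ck_starP ck).
have Pq v : P v ** q = P v by rewrite -[LHS]starK starM qS (ck_starP ck) qP (ck_starP ck).
have qSe e : q ** S e = S e by rewrite -(ck_srcS ck) smulA qP.
have Seq e : S e ** q = S e by rewrite -(ck_SP ck) -smulA Pq.
have qq : q ** q = q by rewrite {2}/q smul_sumr; apply: eq_bigr => v _; rewrite qP.
(* The symmetry 2q - 1 is a self-adjoint unitary. Since q is a unit for the generators, conjugation
   by u fixes them and is the identity, so q commutes with every element. *)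
pose u : X := q + q - sone.
have us : star u = u by rewrite !(starD, starN) qS star_sone.
have ux x : u ** x = q ** x + q ** x - x by rewrite !smulDl smulNx smul1x.
have xu x : x ** u = x ** q + x ** q - x by rewrite !smulDr smulxN smulx1.
have uu : star u ** u = sone by rewrite us ux xu qq addrK /u opprB addrC subrK.
clearbody u.
have adE x : q ** x = x -> x ** q = x -> ad_hom uu x = x.
  by move=> qx xq; rewrite ad_homE us ux qx addrK xu xq addrK.
have cent x : q ** x = x ** q.
  have : ad_hom uu x = x by apply: gauge_id => [v|e]; apply: adE.
  move=> /(congr1 (fun y => y ** u)); rewrite ad_homE -!smulA uu smulx1.
  rewrite ux xu => h; have {}h := addIr _ h.
  have two0 : (2 : C) != 0 by rewrite pnatr_eq0.
  by apply: (scalerI two0); rewrite !scaler_nat !mulr2n.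
(* As q is a central projection, x |-> q x is a *-homomorphism. It fixes the generators, so it is
   the identity, and its value at [sone] is q. *)
have lq : linear (fun x : X => q ** x) by move=> a x y; rewrite smulDr smulZr.
have mq (x y : X) : q ** (x ** y) = (q ** x) ** (q ** y).
  by rewrite -smulA [x ** (q ** y)]smulA -cent -smulA [RHS]smulA qq.
have sq (x : X) : q ** star x = star (q ** x) by rewrite starM qS cent.
have := gauge_id (psi := starHom_of lq mq sq) qP qSe sone.
by rewrite starHom_ofE smulx1.
Qed.

Lemma pathV_ortho i j : star (V i) ** V j = if i == j then P (spath i).2 else 0.
Proof. by rewrite (star_path_op ck) ?spathP // (inj_eq (@spath_inj _)). Qed.

Lemma sum_pi : \sum_(i : idx) pi i = sone.
Proof.
rewrite -sum_P.
have -> : \sum_(i : idx) pi i =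
    \sum_(m <- sink_paths E) path_op P S m ** star (path_op P S m).
  by rewrite [RHS]big_tnth.
rewrite big_allpairs_dep /= big_enum; apply: eq_bigr => u _.
rewrite -(P_eq_sum_paths ck) // => p v /(size_path acyclicE); exact: ltnW.
Qed.

Lemma pi_V i j : pi i ** V j = if i == j then V j else 0.
Proof.
rewrite -smulA pathV_ortho; case: eqP => [->|]; last by rewrite smulx0.
by rewrite (path_opP ck).
Qed.

(** As the V_i V_i^* sum to 1, the V_i serve as a basis on which identities can be tested. *)
Lemma eq_on_V (x y : X) : (forall i, x ** V i = y ** V i) -> x = y.
Proof.
move=> xy; rewrite -[x]smulx1 -[y]smulx1 -sum_pi !smul_sumr.
by apply: eq_bigr => i _; rewrite !smulA xy.
Qed.

(** The diagonal operator with eigenvalue g(m) at the path m. *)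
Definition diagop (g : seq (edge E) * vertex E -> C) : X :=
  \sum_(i : idx) g (spath i) *: pi i.

Lemma diagop_V g i : diagop g ** V i = g (spath i) *: V i.
Proof.
rewrite smul_suml (bigD1 i) //= smulZl pi_V eqxx big1 ?addr0 // => j ji.
by rewrite smulZl pi_V (negbTE ji) scaler0.
Qed.

Lemma diagop_path g m : sink_path m -> diagop g ** path_op P S m = g m *: path_op P S m.
Proof. by move=> /(spath_surj acyclicE)[i <-]; exact: diagop_V. Qed.

Lemma diagop_star g : star (diagop g) = diagop (fun m => (g m)^*).
Proof.
by rewrite star_sum; apply: eq_bigr => i _; rewrite starZ starM starK.
Qed.

Lemma diagop_mul g h : diagop g ** diagop h = diagop (fun m => g m * h m).
Proof.
by apply: eq_on_V => i; rewrite -smulA diagop_V smulZr !diagop_V scalerA mulrC.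
Qed.

Lemma diagop1 : diagop (fun=> 1) = sone.
Proof. by rewrite -sum_pi; apply: eq_bigr => i _; rewrite scale1r. Qed.

Lemma diagop_unitary g : (forall m, `|g m| = 1) -> star (diagop g) ** diagop g = sone.
Proof.
move=> g1; rewrite diagop_star diagop_mul -diagop1; congr diagop.
by apply/funext => m; rewrite mulrC -normCK g1 expr1n.
Qed.

(** By [gauge_uniq], conjugation by [diagop g] need only be computed on generators, and there on the
    V_i. It fixes P_v, which is diagonal too. It multiplies S_e by z because S_e V_m is either 0 or
    V_em, and g(em) = z g(m). *)
Lemma gauge_inner (z : C) (z1 : `|z| = 1) g : (forall m, `|g m| = 1) ->
  (forall e m, g (pcons e m) = z * g m) ->
  forall x, diagop g ** x = gauge X z1 x ** diagop g.
Proof.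
move=> g1 gz x.
have gu := diagop_unitary g1.
have ug : diagop g ** star (diagop g) = sone.
  rewrite diagop_star diagop_mul -diagop1; congr diagop.
  by apply/funext => m; rewrite -normCK g1 expr1n.
rewrite -(gauge_uniq z1 (psi := ad_hom gu)).
- by rewrite ad_homE -smulA gu smulx1.
- move=> v; rewrite ad_homE -[RHS]smulx1 -ug smulA; congr (_ ** _).
  apply: eq_on_V => i; rewrite -!smulA diagop_V smulZr !(P_path_op ck).
  by case: ifP => _; rewrite ?diagop_V // smulx0 scaler0.
move=> e; rewrite ad_homE -[RHS]smulx1 -ug smulA; congr (_ ** _).
apply: eq_on_V => i; rewrite -!smulA diagop_V smulZr smulZl.
have [st|st] := boolP (start (spath i) == rng e).
  rewrite -path_op_cons diagop_path ?gz ?scalerA ?[_ * z]mulrC //.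
  by rewrite sink_path_cons st spathP.
suff -> : S e ** V i = 0 by rewrite smulx0 !scaler0.
by rewrite -(ck_SP ck) -smulA (P_path_op ck) eq_sym (negbTE st) smulx0.
Qed.

End GaugeIsInner.

(** * The path representation *)

Section PathRepresentation.
Local Open Scope ring_scope.
Context (R : realType) (E : digraph).
Hypothesis acyclicE : acyclic E.
Local Notation idx := ('I_(size (sink_paths E))).
Local Notation M := (opmx R (size (sink_paths E))).
Implicit Types (D : pred idx) (i j : idx).

Definition diagmx D : M := \matrix_(i, j) ((i == j) && D i)%:R.

(** On columns, the basis vector of m goes to that of em. Composability is implicit: [spath i] is a
    path, so equality forces m to start at the range of e. *)
Definition shift e : M := \matrix_(i, j) (spath i == pcons e (spath j))%:R.

Definition starts v : pred idx := fun i => start (spath i) == v.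

Definition leads e : pred idx := fun i => ohead (spath i).1 == Some e.

Lemma shiftP e i j : spath i = pcons e (spath j) -> leads e i /\ starts (rng e) j.
Proof.
move=> ij; have := spathP acyclicE i; rewrite ij sink_path_cons => /andP[st _].
by split=> //; rewrite /leads ij /= eqxx.
Qed.

Lemma shift_dom e j : starts (rng e) j -> exists i, spath i = pcons e (spath j).
Proof.
by move=> st; apply: spath_surj => //; rewrite sink_path_cons (spathP acyclicE) andbT.
Qed.

Lemma shift_im e i : leads e i -> exists j, spath i = pcons e (spath j).
Proof.
rewrite /leads; case sp : (spath i) => [[|f p] v] //= /eqP[fe].
have := spathP acyclicE i; rewrite sp -[(f :: p, v)]/(pcons f (p, v)) sink_path_cons fe.
by case/andP => _ /(spath_surj acyclicE)[j jp]; exists j; rewrite jp.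
Qed.

Lemma star_diagmx D : star (diagmx D) = diagmx D.
Proof.
apply/matrixP => i j; rewrite !mxE rmorph_nat eq_sym.
by case: eqP => // ->.
Qed.

Lemma diagmx_mul D D' : diagmx D ** diagmx D' = diagmx (predI D D').
Proof.
apply/matrixP => i j; rewrite !mxE (bigD1 i) //= big1 ?addr0.
  by rewrite !mxE eqxx /= -natrM mulnb andbCA.
by move=> l li; rewrite !mxE eq_sym (negbTE li) mul0r.
Qed.

Lemma eq_diagmx D D' : D =1 D' -> diagmx D = diagmx D'.
Proof. by move=> DD; apply/matrixP => i j; rewrite !mxE DD. Qed.

Lemma diagmx0 D : D =1 pred0 -> diagmx D = 0.
Proof. by move=> D0; apply/matrixP => i j; rewrite !mxE D0 andbF. Qed.

(** The entries of the products of shifts and their adjoints count intermediate paths, of which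
    there is at most one. *)
Lemma sum_nat_eq1 (I : finType) (F : pred I) : {in F &, forall x y, x = y} ->
  \sum_i (F i)%:R = ([exists i, F i])%:R :> R[i].
Proof.
move=> F1; case: existsP => [[x Fx]|nF].
  rewrite (bigD1 x) //= Fx big1 ?addr0 // => y yx.
  by case Fy: (F y) => //; rewrite (F1 y x) ?eqxx in yx.
by apply: big1 => i _; case Fi : (F i) => //; case: nF; exists i.
Qed.

Lemma star_shift_shift e f :
  star (shift e) ** shift f = if e == f then diagmx (starts (rng e)) else 0.
Proof.
apply/matrixP => i j; rewrite !mxE.
under eq_bigr do rewrite !mxE rmorph_nat -natrM mulnb.
rewrite sum_nat_eq1; last first.
  by move=> l m /andP[/eqP l1 _] /andP[/eqP m1 _]; apply: spath_inj; rewrite l1 m1.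
have [<-|ef] := eqVneq e f; last first.
  rewrite mxE; case: existsP => // -[l /andP[/eqP -> /eqP/pcons_inj[ef']]].
  by rewrite ef' eqxx in ef.
rewrite mxE; congr (_%:R); apply: congr1; apply/existsP/andP.
  move=> [l /andP[/eqP li /eqP lj]]; have [_ st] := shiftP li.
  by split=> //; apply/eqP/spath_inj; move: lj; rewrite li => /pcons_inj[].
by move=> [/eqP <- /shift_dom[l lj]]; exists l; rewrite lj eqxx.
Qed.

Lemma shift_star_shift e : shift e ** star (shift e) = diagmx (leads e).
Proof.
apply/matrixP => i j; rewrite !mxE.
under eq_bigr do rewrite !mxE rmorph_nat -natrM mulnb.
rewrite sum_nat_eq1; last first.
  move=> l m /andP[/eqP l1 _] /andP[/eqP]; rewrite l1 => /pcons_inj[_ lm] _.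
  exact: spath_inj.
congr (_%:R); apply: congr1; apply/existsP/andP.
  move=> [l /andP[/eqP il /eqP jl]]; have [le _] := shiftP il; split=> //.
  by apply/eqP/spath_inj; rewrite il jl.
by move=> [/eqP <- /shift_im[l lj]]; exists l; rewrite lj eqxx.
Qed.

Lemma path_rep_ck : cuntz_krieger (fun v => diagmx (starts v)) shift.
Proof.
have lead_st e i : leads e i -> starts (src e) i.
  by rewrite /leads /starts /start; case: (spath i) => [[|f p] v] //= /eqP[->].
split.
- move=> v; split; first exact: star_diagmx.
  by rewrite diagmx_mul; apply: eq_diagmx => i /=; rewrite andbb.
- move=> v w vw; rewrite diagmx_mul; apply: diagmx0 => i /=.
  by apply/negP => /andP[/eqP iv /eqP iw]; rewrite -iv -iw eqxx in vw.
- move=> e; rewrite /is_partial_isometry -smulA star_shift_shift eqxx.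
  apply/matrixP => i j; rewrite !mxE (bigD1 j) //= big1 ?addr0.
    rewrite !mxE eqxx /= -natrM mulnb; congr (_%:R); apply: congr1.
    by case: eqP => // /shiftP[_ ->].
  by move=> l lj; rewrite !mxE (negbTE lj) mulr0.
- move=> e f ef; rewrite !shift_star_shift diagmx_mul; apply: diagmx0 => i /=.
  by apply/negP => /andP[/eqP ie /eqP]; rewrite ie => -[/eqP]; rewrite (negbTE ef).
- by move=> e; rewrite star_shift_shift eqxx.
(* The difference is the projection onto the paths from the source of e whose first edge is not e,
   and a projection p equals p^* p. *)
- move=> e; exists (diagmx (predD (starts (src e)) (leads e))).
  rewrite star_diagmx diagmx_mul shift_star_shift; apply/matrixP => i j.
  rewrite !mxE /=; case: (i == j) => /=; last by rewrite subr0.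
  rewrite andbb; case le : (leads e i) => /=; last by rewrite subr0.
  by rewrite lead_st ?subrr.
move=> v [e0 e0v]; apply/matrixP => i j; rewrite summxE.
under eq_bigr do rewrite shift_star_shift mxE.
have [ij|ij] := boolP (i == j); last by rewrite mxE (negbTE ij) big1.
rewrite mxE big_mkcond /= ij /=.
transitivity (\sum_e ((src e == v) && leads e i)%:R : R[i]); last first.
  by apply: eq_bigr => e _; case: (src e == v).
rewrite sum_nat_eq1; last first.
  by move=> e f /andP[_ /eqP le] /andP[_ /eqP]; rewrite le => -[].
congr (_%:R); apply: congr1; apply/idP/existsP; last first.
  by move=> [e /andP[/eqP <- /lead_st]].
(* Since v emits the edge e0, it is not a sink, so a path from v to a sink has a first edge. *)
rewrite /starts /leads; have /andP[/forallP + _] := spathP acyclicE i.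
case: (spath i) => [[|e p] w] /=; rewrite /start /= => sw; [move=> /eqP wv|move=> ev].
  by have := sw e0; rewrite e0v wv eqxx.
by exists e; rewrite ev eqxx.
Qed.

End PathRepresentation.

Section SinkProjectionNonzero.
Local Open Scope ring_scope.

(** In the path representation the diagonal entry of the image of P_v at the empty path at v is
    1. *)
Lemma ga_P_neq0 (R : realType) (E : digraph) (X : graph_algebra R[i] E) (v : vertex E) :
  acyclic E -> sink v -> ga_P X v != 0.
Proof.
move=> acyclicE sv; apply/eqP => Pv0.
have [phi [phiP _ _]] := @ga_univ _ _ X _ _ _ (path_rep_ck R acyclicE).
have [|i iv] := @spath_surj E acyclicE ([::], v).
  by rewrite /sink_path /start /= eqxx andbT; apply/sinkP.
have := phiP v; rewrite Pv0 linear0 => /matrixP/(_ i i)/eqP.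
by rewrite !mxE eqxx /starts iv /start /= eqxx /= eq_sym oner_eq0.
Qed.

End SinkProjectionNonzero.

(** * Freeness, local triviality and paths *)

Section RootsOfUnity.
Local Open Scope ring_scope.
Context (R : realType).

(** If cos x = 1, the double angle formula gives sin (x / 2) = 0, although x / 2 lies strictly
    between 0 and pi. *)
Lemma cis_neq1 (x : R) : 0 < x < 2 * pi -> cis x != 1.
Proof.
move=> /andP[x0 xpi]; apply/eqP => -[cx _].
have s0 : 0 < sin (x / 2).
  by apply: sin_gt0_pi; rewrite divr_gt0 //= ltr_pdivrMr // mulrC.
have := cos_mulr2n (x / 2); rewrite -[x / 2 *+ 2]mulr_natr divfK ?pnatr_eq0 // cx.
have := cos2Dsin2 (x / 2); nra.
Qed.

Lemma cisX (x : R) n : cis x ^+ n = cis (n%:R * x).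
Proof.
elim: n => [|n IHn]; first by rewrite mul0r /cis cos0 sin0.
by rewrite exprS IHn -cisD -natr1 mulrDl mul1r addrC.
Qed.

Context (k : nat).
Local Notation zeta := (@Defs.root_of_unity R k).
Implicit Types (g h : cyc k).

Lemma root_of_unityX g n : zeta (g ^+ n)%g = zeta g ^+ n.
Proof.
elim: n => [|n IHn]; first by rewrite root_of_unity1.
by rewrite expgS root_of_unityM IHn exprS.
Qed.

Lemma root_of_unity_eq1 g : (zeta g == 1) = (g == 1%g).
Proof.
apply/idP/eqP => [|->]; last by rewrite root_of_unity1.
apply: contraTeq => g1; apply: cis_neq1.
have m0 : 0 < k.-1.+1%:R :> R by rewrite ltr0n.
have g0 : (0 < (g : 'I_k.-1.+1))%N by rewrite lt0n.
have p0 : 0 < pi :> R := pi_gt0 R.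
rewrite divr_gt0 ?mulr_gt0 ?ltr0n //= ltr_pdivrMr // mulrC.
by rewrite ltr_pM2l ?mulr_gt0 // ltr_nat ltn_ord.
Qed.

Lemma root_of_unity_expr g : zeta g ^+ k.-1.+1 = 1.
Proof.
by rewrite cisX mulrC divfK ?pnatr_eq0 // cis_2pi.
Qed.

Lemma root_of_unityV g : zeta g^-1%g = (zeta g)^*.
Proof.
apply: (@mulfI _ (zeta g)).
  by rewrite -normr_eq0 norm_root_of_unity oner_eq0.
by rewrite -root_of_unityM mulgV root_of_unity1 -normCK norm_root_of_unity expr1n.
Qed.

(** The class of 1, which is the neutral element when k = 1. *)
Definition cyc_gen : cyc k := inZp 1.

Lemma root_of_unity_gen_neq1 n : (0 < n < k)%N -> zeta cyc_gen ^+ n != 1.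
Proof.
move=> /andP[n0 nk]; rewrite -root_of_unityX root_of_unity_eq1.
rewrite [X in X == _]Zp_expg; apply/eqP => /(congr1 val) /=.
have k0 : (0 < k)%N by apply: leq_trans nk.
rewrite modnMml mul1n prednK // modn_small // => n0'.
by rewrite n0' in n0.
Qed.

End RootsOfUnity.

(** * From freeness to paths *)

Section FreenessToPaths.
Local Open Scope ring_scope.
Local Open Scope classical_set_scope.
Context (R : realType) (E : digraph) (X : graph_algebra R[i] E) (k : nat).
Hypothesis acyclicE : acyclic E.
Local Notation P := (@ga_P _ E X).
Local Notation S := (@ga_S _ E X).
Local Notation ck := (ga_ck X).
Local Notation V i := (path_op P S (spath (E := E) i)).
Local Notation zeta := (@Defs.root_of_unity R k).

Lemma zeta_character : is_character (fun g : cyc k => zeta g).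
Proof. by split; [move=> g; exact: norm_root_of_unity|exact: root_of_unityM]. Qed.

(** P_v is the operator of the empty path at v, hence an eigenvector of diagonal operators; taking
    adjoints changes sides. *)
Lemma P_diagop f v : sink v -> P v ** diagop X f = f ([::], v) *: P v.
Proof.
move=> sv; rewrite -[LHS]starK starM diagop_star (ck_starP ck).
have sp : sink_path ([::], v) by rewrite /sink_path /start /= eqxx andbT; apply/sinkP.
rewrite -[P v]/(path_op P S ([::], v)) diagop_path // starZ conjCK.
by rewrite [path_op _ _ _](_ : _ = P v) // (ck_starP ck).
Qed.

Lemma sink_spectral_eq0 v a : sink v -> (1 < k)%N ->
  ~ (exists u p, is_path u p v /\ size p = k.-1) ->
  spectral_subspace (cyc_gauge X k) (fun g : cyc k => zeta g) a -> P v ** a = 0.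
Proof.
move=> sv k1 nopath; set z := zeta (cyc_gen k) => sa.
pose z1 := norm_root_of_unity R (cyc_gen k).
have ga : gauge X z1 a = z *: a by exact: sa.
(* On the left P_v absorbs [diagop X f], since f is 1 at the vertex v. Moving that operator past a
   costs the factor z, and V_i then turns it into the scalar f(spath i). *)
have key f : (forall m, `|f m| = 1) -> (forall e m, f (pcons e m) = z * f m) ->
    f ([::], v) = 1 -> forall i, P v ** a ** V i = (z * f (spath i)) *: (P v ** a ** V i).
  move=> f1 fz fv i.
  have := gauge_inner acyclicE z1 f1 fz a; rewrite ga => fa.
  have Pf : P v ** diagop X f = P v by rewrite P_diagop // fv scale1r.
  rewrite -{1}Pf -[P v ** _ ** a]smulA fa.
  by rewrite -!smulA diagop_V // smulZl !smulZr scalerA.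
apply: eq_on_V => // i; rewrite smul0x.
set w := P v ** a ** V i; set n := size (spath i).1.
have zn m : `|z ^+ m| = 1 by rewrite normrX z1 expr1n.
have [vi|vi] := eqVneq (spath i).2 v.
  have wz : w = z ^+ n.+1 *: w.
    by rewrite exprS; apply: (key (fun m => z ^+ size m.1)) => // e m; rewrite exprS.
  have zn1 : z ^+ n.+1 != 1.
    (* Here n + 1 < k, since a path of length at least k - 1 to v would have a final segment of
       length exactly k - 1. *)
    apply: root_of_unity_gen_neq1; rewrite ltnS /=.
    rewrite ltnNge; apply/negP => kn; apply: nopath.
    have := spathP acyclicE i; rewrite /sink_path vi => /andP[_].
    rewrite -[(spath i).1](cat_take_drop (n.+1 - k)%N) => /is_path_catr[u up].
    exists u, (drop (n.+1 - k) (spath i).1); split=> //.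
    by rewrite size_drop -/n; lia.
  have /eqP : (z ^+ n.+1 - 1) *: w = 0 by rewrite scalerBl -wz scale1r subrr.
  by rewrite scaler_eq0 subr_eq0 (negbTE zn1) => /eqP.
(* On paths to sinks other than v the sign of f is free; the two choices give w = c w and w = - c w
   with the same c. *)
have wz (b : bool) : w = (z * (z ^+ n * (-1) ^+ b)) *: w.
  rewrite {1}/w (key (fun m => z ^+ size m.1 * (-1) ^+ (b && (m.2 != v)))).
  - by rewrite vi andbT.
  - by move=> m; rewrite normrM zn mul1r normr_sign.
  - by move=> e m; rewrite /= exprS mulrA.
  - by rewrite /= eqxx andbF expr0 mulr1.
have ww : w = - w.
  by rewrite {1}(wz true) expr1 mulrN1 mulrN scaleNr {2}(wz false) expr0 mulr1.
have /eqP : (2 : R[i]) *: w = 0 by rewrite scaler_nat mulr2n {1}ww addNr.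
by rewrite scaler_eq0 pnatr_eq0 => /eqP.
Qed.

Lemma free_paths : (0 < k)%N -> free_action (cyc_gauge X k) ->
  forall v : vertex E, sink v -> exists u p, is_path u p v /\ size p = k.-1.
Proof.
move=> k0 free v sv; have [k1|k1] := leqP k 1.
  by exists v, [::]; rewrite /= eqxx; split=> //; case: k k0 k1 => [|[]].
apply: contrapT => nopath.
have Pspan x : lin_span [set x | exists a b : X,
      [/\ spectral_subspace (cyc_gauge X k) (fun g => zeta g) a,
          spectral_subspace (cyc_gauge X k) (fun g => zeta g) b
        & x = a ** star b]] x -> P v ** x = 0.
  move=> [n [c [s [sP ->]]]]; rewrite smul_sumr big1 // => j _.
  have [a [b [aP _ ->]]] := sP j.
  by rewrite smulZr smulA (sink_spectral_eq0 sv) // smul0x scaler0.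
have := free _ zeta_character; rewrite /closure /= => cl.
have h0 : (0 : R[i]) < 2^-1 by rewrite invr_gt0 ltr0n.
(* If x in the span is within 1/2 of 1, then P_v = P_v (1 - x) has norm less than its own norm, as
   P_v is not 0. *)
have [x [/Pspan Px]] := cl _ (nbhsx_ballx (sone : X) 2^-1 h0).
rewrite -ball_normE /= => x1.
have Pv : P v = P v ** (sone - x) by rewrite smulDr smulxN Px smulx1 subr0.
have Pv0 : 0 < `|P v| by rewrite normr_gt0 ga_P_neq0.
have := normM_le (P v) (sone - x); rewrite -Pv -[leLHS]mulr1 ler_pM2l // => h1.
have := le_lt_trans h1 x1; rewrite invf_gt1 ?ltr0n //.
by rewrite -[1 in X in _ < X]/(1%:R) ltr_nat.
Qed.

End FreenessToPaths.

(** * From covers to freeness *)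

Section CoverToFree.
Local Open Scope ring_scope.
Local Open Scope classical_set_scope.
Context (R : realType).

Lemma C0_sqrt_subproof :
  (fun x : R => if 0 < x <= 1 then (Num.sqrt x)%:C%C else 0) \in @C0_pred R.
Proof.
apply/C0_predP; split=> [|x]; last by case: ifP.
apply: (@subspace_eq_continuous _ _ _ (fun x : R => (Num.sqrt x)%:C%C : (R[i])^o)).
  move=> x; rewrite inE /= in_itv /= => /andP[x0 x1].
  rewrite /from_subspace x1 andbT lt_neqAle x0 andbT eq_sym.
  by have [->|] := eqVneq x 0; rewrite ?sqrtr0.
apply: continuous_subspaceT => x.
apply/(@cvgrPdist_le _ (R[i])^o) => e e0.
case: e e0 => e e' /=; rewrite ltcE /= => /andP[/eqP e'0 re0].
have : \forall y \near x, `|Num.sqrt x - Num.sqrt y| <= e.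
  have /(@cvgrPdist_le _ R^o)/(_ _ re0) := @sqrt_continuous R x.
  exact.
apply: filterS => y /= xy.
suff: `|(Num.sqrt x)%:C%C - (Num.sqrt y)%:C%C| <= e%:C%C by rewrite e'0.
by rewrite -rmorphB /= normc_real lecR.
Qed.

Definition C0_sqrt : C0_01 R := C0Fun C0_sqrt_subproof.

Lemma C0_sqrtM : C0_sqrt ** star C0_sqrt = C0_id R.
Proof.
apply: C0_ext => x /=; case: ifP => [/andP[x0 _]|_]; last by rewrite mul0r.
rewrite [X in _ * X]conjc_real -rmorphM /=.
by rewrite -expr2 sqr_sqrtr // ltW.
Qed.

(** The sum s of the a_i a_i^* is invariant, and so is its inverse y. Hence y^* a_i is again in the
    spectral subspace, and 1 = s y is the sum of the a_i (y^* a_i)^*: it lies in the span itself. *)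
Lemma WLT_cover_free (G : finGroupType) (A : unitalCstarAlgType R[i])
  (alpha : cstar_action G A) n : WLT_cover alpha n -> free_action alpha.
Proof.
move=> [rho [equi [y [sy ys]]]] chi [chi1 chiM].
set s := \sum_(i < _) _ in sy ys.
have trans1 g : translate g (tensor (C0_id R) (fun _ : G => 1)) =
    tensor (C0_id R) (fun _ : G => 1).
  by apply/ffunP => h; rewrite !ffunE.
have alpha_s g : alpha g s = s.
  by rewrite linear_sum; apply: eq_bigr => i _; rewrite /= -equi trans1.
have alpha1 g : alpha g sone = sone.
  rewrite -[LHS]smulx1 -[X in _ ** X](Defs.act1 alpha) -(mulgV g) Defs.actM.
  by rewrite -star_homM smul1x -Defs.actM mulgV Defs.act1.
have alpha_y g : alpha g y = y.
  by rewrite -[LHS]smulx1 -sy smulA -{1}(alpha_s g) -star_homM ys alpha1 smul1x.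
pose a i := rho i (tensor C0_sqrt chi).
have a_spec i : spectral_subspace alpha chi (a i).
  move=> g; rewrite -equi -linearZ /=; congr (rho i _).
  by apply/ffunP => h; rewrite !ffunE chiM mulrC scalerA.
have aa i : a i ** star (a i) = rho i (tensor (C0_id R) (fun=> 1)).
  rewrite -star_homS -star_homM; congr (rho i _); apply/ffunP => h.
  rewrite !ffunE smulZl starZ smulZr scalerA C0_sqrtM.
  by rewrite -normCK chi1 expr1n.
apply: subset_closure; exists n.+1, (fun=> 1), (fun i => a i ** star (star y ** a i)).
split=> [i|]; last first.
  rewrite -sy smul_suml; apply: eq_bigr => i _.
  by rewrite scale1r starM starK smulA aa.
exists (a i), (star y ** a i); split=> // g.
by rewrite star_homM star_homS alpha_y a_spec smulZr.
Qed.

End CoverToFree.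

Section WLTDim.
Context (R : realType) (G : finGroupType) (A : unitalCstarAlgType R[i]).

Lemma WLT_dimP (alpha : cstar_action G A) :
  (exists n, WLT_dim alpha = Some n) <-> exists n, WLT_cover alpha n.
Proof.
rewrite /WLT_dim; case: pselect => [ex|nex]; split.
- by move=> _; have [n /asboolP] := ex; exists n.
- by exists (ex_minn ex).
- by case.
- by move=> [n cov]; case: nex; exists n; apply/asboolP.
Qed.

End WLTDim.

(** * Equivariant homomorphisms from Fourier transforms *)

Section CyclicIsometries.
Local Open Scope ring_scope.
Context (R : realType) (E : digraph) (X : graph_algebra R[i] E) (k : nat).
Local Notation G := (cyc k).
Local Notation K := k.-1.+1.
Local Notation zeta := (@Defs.root_of_unity R k).

Let K0 : K%:R != 0 :> R[i].
Proof. by rewrite pnatr_eq0. Qed.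

(** Orthogonality of characters: for distinct g and h the geometric sum is annihilated by the
    nonzero number zeta(g h^-1) - 1. *)
Lemma zeta_sum (g h : G) :
  \sum_(i < K) zeta g ^+ i * (zeta h ^+ i)^* = if g == h then K%:R else 0.
Proof.
have zi i : zeta g ^+ i * (zeta h ^+ i)^* = zeta (g * h^-1)%g ^+ i.
  by rewrite root_of_unityM root_of_unityV exprMn rmorphXn.
under eq_bigr do rewrite zi.
have [->|gh] := eqVneq g h.
  rewrite mulgV root_of_unity1 (eq_bigr (fun=> 1)) => [|i _]; last exact: expr1n.
  by rewrite sumr_const card_ord.
apply: (@mulfI _ (zeta (g * h^-1)%g - 1)).
  rewrite subr_eq0 root_of_unity_eq1; apply: contraNneq gh => gh1.
  by rewrite -(mulgKV h g) gh1 mul1g.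
by rewrite -subrX1 root_of_unity_expr subrr mulr0.
Qed.

(** The pairing of Z/k with its dual is symmetric, so [zeta_sum] also gives orthogonality for sums
    over the group. *)
Lemma zetaC (i j : G) : zeta i ^+ (j : 'I_K) = zeta j ^+ (i : 'I_K).
Proof. by rewrite !cisX !mulrA [_%:R * _%:R]mulrC. Qed.

Context (p : X) (W : 'I_K -> X).
Hypotheses (WW : forall i j, star (W i) ** W j = if i == j then p else 0)
  (Wp : forall i, W i ** p = W i)
  (gW : forall (g : G) i, cyc_gauge X k g (W i) = zeta g ^+ i *: W i).

(** This is the square root of K times a partial isometry with initial projection p; [spectral_proj]
    restores the normalisation. *)
Definition fourier (h : G) : X := \sum_(i < K) (zeta h ^+ i)^* *: W i.

Lemma fourier_gauge (g h : G) :
  cyc_gauge X k g (fourier h) = fourier (h * g^-1)%g.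
Proof.
rewrite linear_sum; apply: eq_bigr => i _; rewrite linearZ /= gW scalerA.
congr (_ *: _); rewrite root_of_unityM root_of_unityV exprMn rmorphM /=.
by rewrite !rmorphXn /= conjCK.
Qed.

Lemma fourierp h : fourier h ** p = fourier h.
Proof.
by rewrite smul_suml; apply: eq_bigr => i _; rewrite smulZl Wp.
Qed.

Lemma fourier_ortho (g h : G) :
  star (fourier g) ** fourier h = (if g == h then K%:R else 0) *: p.
Proof.
rewrite star_sum smul_suml -zeta_sum scaler_suml; apply: eq_bigr => i _.
rewrite starZ conjCK smul_sumr (bigD1 i) //= big1 ?addr0.
  by rewrite smulZl smulZr WW eqxx scalerA.
by move=> j ji; rewrite smulZl smulZr WW eq_sym (negbTE ji) !scaler0.
Qed.

Definition spectral_proj (h : G) : X := K%:R^-1 *: (fourier h ** star (fourier h)).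

Lemma spectral_projM (g h : G) :
  spectral_proj g ** spectral_proj h = if g == h then spectral_proj h else 0.
Proof.
rewrite smulZl smulZr -smulA [star _ ** _]smulA fourier_ortho.
have [->|_] := eqVneq g h; last by rewrite scale0r smul0x smulx0 !scaler0.
by rewrite smulZl smulZr [_ ** (p ** _)]smulA fourierp
  [_^-1 *: (K%:R *: _)]scalerA mulVf // scale1r.
Qed.

Lemma spectral_proj_star h : star (spectral_proj h) = spectral_proj h.
Proof. by rewrite starZ fmorphV rmorph_nat starM starK. Qed.

Lemma spectral_proj_gauge (g h : G) :
  cyc_gauge X k g (spectral_proj h) = spectral_proj (h * g^-1)%g.
Proof. by rewrite linearZ /= star_homM star_homS -/(fourier _) fourier_gauge. Qed.

(** Parseval's identity: summing over h removes the products of W_i and W_j^* with i and j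
    distinct. *)
Lemma sum_spectral_proj : \sum_h spectral_proj h = \sum_i W i ** star (W i).
Proof.
rewrite -scaler_sumr.
transitivity (K%:R^-1 *: \sum_(i < K) \sum_(j < K)
    (\sum_(h : G) zeta h ^+ j * (zeta h ^+ i)^*) *: (W i ** star (W j))).
  congr (_ *: _); under eq_bigr do rewrite star_sum smul_suml.
  rewrite exchange_big; apply: eq_bigr => i _.
  under eq_bigr do rewrite smul_sumr; rewrite exchange_big; apply: eq_bigr => j _.
  rewrite scaler_suml; apply: eq_bigr => h _.
  by rewrite starZ conjCK smulZl smulZr scalerA mulrC.
rewrite scaler_sumr; apply: eq_bigr => i _.
have zz (j : 'I_K) : \sum_(h : G) zeta h ^+ j * (zeta h ^+ i)^* = if j == i then K%:R else 0.
  by rewrite -zeta_sum; apply: eq_bigr => h _; rewrite !(zetaC h).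
rewrite (bigD1 i) //= zz eqxx big1 ?addr0 => [|j ji].
  by rewrite scalerA mulVf // scale1r.
by rewrite zz (negbTE ji) scale0r.
Qed.

Definition eval1 (F : tensC G (C0_01 R)) (h : G) : R[i] := C0_val (F h) 1.

(** The cone is evaluated at its end t = 1, and the resulting function on G is represented by the
    orthogonal projections [spectral_proj h]. *)
Definition cone_fun (F : tensC G (C0_01 R)) : X :=
  \sum_h eval1 F h *: spectral_proj h.

Lemma cone_linear : linear cone_fun.
Proof.
move=> a F H; rewrite /cone_fun scaler_sumr -big_split; apply: eq_bigr => h _.
have -> : eval1 (a *: F + H) h = a * eval1 F h + eval1 H h by rewrite /eval1 !ffunE.
by rewrite scalerDl -scalerA.
Qed.

Lemma cone_funM F H : cone_fun (F ** H) = cone_fun F ** cone_fun H.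
Proof.
rewrite /cone_fun smul_suml; apply: eq_bigr => h _.
have qq g : (eval1 F h *: spectral_proj h) ** (eval1 H g *: spectral_proj g) =
    (eval1 F h * eval1 H g) *: (if h == g then spectral_proj g else 0).
  by rewrite smulZl smulZr scalerA spectral_projM.
rewrite smul_sumr (eq_bigr _ (fun g _ => qq g)) (bigD1 h) //=.
rewrite eqxx big1 ?addr0 => [|g gh]; last by rewrite eq_sym (negbTE gh) scaler0.
by congr (_ *: _); rewrite /eval1 ffunE.
Qed.

Lemma cone_funS F : cone_fun (star F) = star (cone_fun F).
Proof.
rewrite /cone_fun star_sum; apply: eq_bigr => h _.
by rewrite starZ spectral_proj_star /eval1 ffunE.
Qed.

Definition cone_hom : starHom (tensC G (C0_01 R)) X :=
  starHom_of cone_linear cone_funM cone_funS.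

Lemma cone_hom_equivariant : equivariant (cyc_gauge X k) cone_hom.
Proof.
move=> g F; rewrite !starHom_ofE /cone_fun linear_sum (reindex_inj (mulIg g^-1%g)).
apply: eq_bigr => h _.
transitivity (eval1 F h *: cyc_gauge X k g (spectral_proj h)); last by rewrite [RHS]linearZ.
by rewrite spectral_proj_gauge /eval1 ffunE mulgKV.
Qed.

Lemma cone_hom_id : cone_hom (tensor (C0_id R) (fun=> 1)) = \sum_i W i ** star (W i).
Proof.
rewrite starHom_ofE -sum_spectral_proj; apply: eq_bigr => h _.
suff -> : eval1 (tensor (C0_id R) (fun=> 1)) h = 1 by rewrite scale1r.
by rewrite /eval1 ffunE scale1r /= ltr01 lexx.
Qed.

End CyclicIsometries.

(** * From paths to covers *)

Section PathsToCover.
Local Open Scope ring_scope.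
Context (R : realType) (E : digraph) (X : graph_algebra R[i] E) (k : nat).
Hypothesis acyclicE : acyclic E.
Local Notation P := (@ga_P _ E X).
Local Notation S := (@ga_S _ E X).
Local Notation ck := (ga_ck X).
Local Notation V i := (path_op P S (spath (E := E) i)).
Local Notation K := k.-1.+1.
Local Notation idx := ('I_(size (sink_paths E))).

Lemma gauge_path (z : R[i]) (z1 : `|z| = 1) m :
  gauge X z1 (path_op P S m) = z ^+ size m.1 *: path_op P S m.
Proof.
case: m => p v; elim: p => [|e p IHp]; first by rewrite scale1r; exact: gaugeP.
rewrite -[(e :: p, v)]/(pcons e (p, v)) path_op_cons star_homM IHp gaugeS.
by rewrite smulZl smulZr scalerA -exprS.
Qed.

Hypothesis long_paths : forall v : vertex E, sink v ->
  exists u p, is_path u p v /\ size p = k.-1.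

(* To each path [i] ending at a sink we attach a system of paths to the same sink,
   one for each length modulo [k], that contains [i]. *)
Lemma path_system : exists M : idx -> 'I_K -> idx, forall i j,
  [/\ (spath (M i j)).2 = (spath i).2, (size (spath (M i j)).1 = j %[mod K])%N
    & (j = size (spath i).1 %% K :> nat)%N -> M i j = i].
Proof.
suff /choice[M MP] : forall ij : idx * 'I_K, exists l : idx,
    [/\ (spath l).2 = (spath ij.1).2, (size (spath l).1 = ij.2 %[mod K])%N
      & (ij.2 = size (spath ij.1).1 %% K :> nat)%N -> l = ij.1].
  by exists (fun i j => M (i, j)) => i j; exact: (MP (i, j)).
move=> [i j] /=; have [ji|ji] := eqVneq (j : nat) (size (spath i).1 %% K)%N.
  by exists i; rewrite ji modn_mod.
have /andP[sv _] := spathP acyclicE i; set v := (spath i).2 in sv *.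
have [u [p [pv pk]]] := long_paths (elimT (sinkP v) sv).
have jk : (j <= k.-1)%N by rewrite -ltnS.
(* For a residue j other than that of i, the final segment of length j of a path of length k - 1 to
   v is taken. *)
move: pv; rewrite -(cat_take_drop (k.-1 - j) p) => /is_path_catr[w wv].
have [|l lp] := @spath_surj E acyclicE (drop (k.-1 - j) p, v).
  by rewrite /sink_path /= sv (is_path_start wv).
exists l; rewrite lp /= size_drop pk subKn //; split=> // ji'.
by rewrite ji' eqxx in ji.
Qed.

(** There is one homomorphism for the system of each path. The systems may overlap, so the sum over
    them is not 1 but a diagonal operator with positive integer eigenvalues. *)
Lemma paths_cover : exists n, WLT_cover (cyc_gauge X k) n.
Proof.
have [M MP] := path_system.
(* A cover of index n has n + 1 members; the extra one, at [None], is the zero homomorphism, so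
   graphs without vertices are included. *)
pose W (o : option idx) j : X := if o is Some i then V (M i j) else 0.
pose p (o : option idx) : X := if o is Some i then P (spath i).2 else 0.
have WW o j l : star (W o j) ** W o l = if j == l then p o else 0.
  case: o => [i|] /=; last by rewrite smulx0 if_same.
  rewrite pathV_ortho //; have [e1 s1 _] := MP i j; have [_ s2 _] := MP i l.
  rewrite e1; have [->|jl] := eqVneq j l; first by rewrite eqxx.
  case: eqP => // jl'; have : (j = l %[mod K])%N by rewrite -s1 -s2 jl'.
  by rewrite !modn_small // => /val_inj jl0; rewrite jl0 eqxx in jl.
have Wp o j : W o j ** p o = W o j.
  case: o => [i|] /=; last by rewrite smulx0.
  by have [<- _ _] := MP i j; rewrite (path_opP ck).
have gW o (g : cyc k) j : cyc_gauge X k g (W o j) = Defs.root_of_unity R g ^+ j *: W o j.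
  case: o => [i|]; last by rewrite linear0 scaler0.
  rewrite /= gauge_path; congr (_ *: _); have [_ s1 _] := MP i j.
  rewrite (divn_eq (size (spath (M i j)).1) K) s1 modn_small // exprD mulnC exprM.
  by rewrite root_of_unity_expr expr1n mul1r.
pose rho (j : 'I_(size (sink_paths E)).+1) :=
  cone_hom (WW (unlift ord0 j)) (Wp _).
exists (size (sink_paths E)), rho; split.
  by move=> j; apply: cone_hom_equivariant; exact: gW.
(* The number of occurrences of m in all the systems; it is positive because m occurs in its own
   system, at the residue of its length. *)
pose mult m := (\sum_i \sum_j (spath (M i j) == m))%N.
have mult0 l : (mult (spath l))%:R != 0 :> R[i].
  have rl : (size (spath l).1 %% K < K)%N by rewrite ltn_mod.
  rewrite pnatr_eq0 /mult (bigD1 l) //= (bigD1 (Ordinal rl)) //=.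
  by have [_ _ ->] := MP l (Ordinal rl); rewrite ?eqxx.
have -> : \sum_(i < _) rho i (tensor (C0_id R) (fun=> 1)) =
    diagop X (fun m => (mult m)%:R).
  apply: (@eq_on_V _ _ _ acyclicE) => l; rewrite diagop_V //.
  rewrite big_ord_recl cone_hom_id unlift_none.
  rewrite big1 ?add0r => [|i _]; last by rewrite smul0x.
  rewrite smul_suml natr_sum scaler_suml; apply: eq_bigr => i _.
  rewrite cone_hom_id liftK smul_suml natr_sum scaler_suml; apply: eq_bigr => j _.
  rewrite pi_V // (inj_eq (@spath_inj _)).
  by case: (M i j == l); rewrite ?scale1r ?scale0r.
exists (diagop X (fun m => (mult m)%:R^-1)); rewrite !(diagop_mul _ acyclicE).
by split; apply: (@eq_on_V _ _ _ acyclicE) => l;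
  rewrite diagop_V // smul1x ?mulfV ?mulVf // scale1r.
Qed.

End PathsToCover.

Theorem corollary4p2 (R : realType) (E : digraph) (X : graph_algebra R[i] E) (k : nat)
    (hE : acyclic E) (hk : 0 < k) :
  (free_action (cyc_gauge X k) <->
     exists n : nat, WLT_dim (cyc_gauge X k) = Some n) /\
  ((exists n : nat, WLT_dim (cyc_gauge X k) = Some n) <->
     (forall v : vertex E, sink v ->
        exists (u : vertex E) (p : seq (edge E)),
          is_path u p v /\ size p = k.-1)).
Proof.
rewrite !WLT_dimP.
have cover_free : (exists n, WLT_cover (cyc_gauge X k) n) -> free_action (cyc_gauge X k).
  by move=> [n]; exact: WLT_cover_free.
have free_path := @free_paths R E X k hE hk.
have path_cover := @paths_cover R E X k hE.
by split; split=> h; auto.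
Qed.
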